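(* There are sets $\mathcal{B}\subseteq\mathbb{N}\setminus\{1\}$ such that, writing $\eta=1_{\mathcal{F}_{\mathcal{B}}}\in\{0,1\}^{\mathbb{Z}}$: (i) $\eta$ is an irregular Toeplitz sequence; (ii) the set of $S$-invariant Borel probability measures on $X_\eta$ contains at least one measure of positive (Kolmogorov-Sinai) entropy. (iii) Moreover, such sets can be found with either of the following additional properties, i.e. there exists a set $\mathcal{B}$ satisfying (i), (ii) and (a), and there exists a set $\mathcal{B}$ satisfying (i), (ii) and (b): (a) $\mathcal{B}$ is not a Besicovitch set, and $\eta$ is quasi-generic for some measure of positive entropy; (b) $\mathcal{B}$ is a Besicovitch set, so $\eta$ is generic for the Mirsky measure $\mu_\eta$, but there is also some $S$-invariant measure of positive entropy on $X_\eta$.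
   Context: $\mathbb{N}=\{1,2,3,\dots\}$. For $\mathcal{B}\subseteq\mathbb{N}$ let $\mathcal{M}_{\mathcal{B}}=\bigcup_{b\in\mathcal{B}}b\mathbb{Z}$ and $\mathcal{F}_{\mathcal{B}}=\mathbb{Z}\setminus\mathcal{M}_{\mathcal{B}}$; $\eta=1_{\mathcal{F}_{\mathcal{B}}}\in\{0,1\}^{\mathbb{Z}}$ is the indicator sequence of $\mathcal{F}_{\mathcal{B}}$. For $M\subseteq\mathbb{Z}$ the lower density $\underline{d}(M)$ and upper density $\overline{d}(M)$ are the $\liminf$ and $\limsup$ of $N^{-1}\operatorname{card}(M\cap[1,N])$ as $N\to\infty$; if they agree, the common value is the density $d(M)$. $\mathcal{B}$ is called a Besicovitch set if $d(\mathcal{M}_{\mathcal{B}})$ exists. $S$ is the left shift on $\{0,1\}^{\mathbb{Z}}$ and $X_\eta$ is the closure of $\{S^n\eta:n\in\mathbb{Z}\}$. The point $\eta$ is generic for an $S$-invariant probability measure $\mu$ on $X_\eta$ if $N^{-1}\sum_{n=1}^N\delta_{S^n\eta}\to\mu$ weakly as $N\to\infty$, and quasi-generic for $\mu$ if this convergence holds along some subsequence $N_i\to\infty$. The Mirsky measure $\mu_\eta$ is the $S$-invariant probability measure on $X_\eta$ that is the weak limit of $N_i^{-1}\sum_{n=1}^{N_i}\delta_{S^n\eta}$ along each subsequence $(N_i)_i$ along which the lower density $\underline{d}(\mathcal{M}_{\mathcal{B}})$ is attained (this limit exists and does not depend on the subsequence). A sequence $\omega\in\{0,1\}^{\mathbb{Z}}$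 is a Toeplitz sequence if for each $n\in\mathbb{Z}$ there is a positive integer $p$ with $\omega_n=\omega_{n+kp}$ for all $k\in\mathbb{Z}$. For $p\in\mathbb{N}$ let $\mathsf{Per}_p(\omega)=\{n\in\mathbb{Z}:\omega_n=\omega_{n+kp}\text{ for all }k\in\mathbb{Z}\}$. A Toeplitz sequence $\omega$ is regular if $\sup_{p\in\mathbb{N}}d(\mathsf{Per}_p(\omega))=1$, and irregular otherwise. *)

(* Defs.v *)
(* MathComp-Analysis *)
From HB Require Import structures.
From mathcomp Require Import all_boot all_order all_algebra.
From mathcomp Require Import all_classical all_reals all_analysis.

Set Implicit Arguments.
Unset Strict Implicit.
Unset Printing Implicit Defensive.

Import Order.TTheory GRing.Theory Num.Theory.
Import numFieldNormedType.Exports.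

Local Open Scope classical_set_scope.
Local Open Scope ring_scope.

(* {0,1}^Z (0 = false, 1 = true) with the product of the discrete topologies
   and the Borel sigma-algebra it generates. *)
Definition biseq : Type := prod_topology (fun _ : int => bool).

HB.instance Definition _ := Pointed.on biseq.
HB.instance Definition _ := Nbhs.on biseq.
HB.instance Definition _ := Topological.on biseq.
HB.instance Definition _ :=
  Measurable.copy biseq (g_sigma_algebraType (@open biseq)).

(* The n-th power S^n, n in Z, of the left shift. *)
Definition shiftz (n : int) (x : biseq) : biseq := fun k => x (k + n).

Definition left_shift : biseq -> biseq := shiftz 1.

Lemma iter_shift (n : nat) (x : biseq) : iter n left_shift x = shiftz n%:Z x.
Proof.
apply/funext => k; elim: n k => [|n IHn] k /=; first by rewrite /shiftz addr0.
by rewrite {1}/left_shift {1}/shiftz IHn /shiftz -addrA intS.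
Qed.

Definition multiples (B : set nat) : set int :=
  \bigcup_(b in B) [set n : int | (b%:Z %| n)%Z].

Definition free_set (B : set nat) : set int := ~` multiples B.

Definition eta (B : set nat) : biseq := fun n => n \in free_set B.

Definition orbit_closure (x : biseq) : set biseq :=
  closure (range (fun n : int => shiftz n x)).

(* N^-1 card(M `&` [1, N]) *)
Definition freq (R : realType) (M : set int) (N : nat) : R :=
  N%:R^-1 * (\sum_(1 <= n < N.+1) (n%:Z \in M))%:R.

Definition lower_density (R : realType) (M : set int) : R :=
  limn_inf (freq R M).

Definition upper_density (R : realType) (M : set int) : R :=
  limn_sup (freq R M).

Definition has_density (R : realType) (M : set int) : Prop :=
  lower_density R M = upper_density R M.

(* Meaningful only under [has_density R M]; it is applied below to periodic
   sets, which always have a density. *)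
Definition density (R : realType) (M : set int) : R := lower_density R M.

Definition besicovitch (R : realType) (B : set nat) : Prop :=
  has_density R (multiples B).

Definition toeplitz (x : biseq) : Prop :=
  forall n : int, exists2 p : nat, (0 < p)%N &
    forall k : int, x n = x (n + k * p%:Z).

Definition per (p : nat) (x : biseq) : set int :=
  [set n : int | forall k : int, x n = x (n + k * p%:Z)].

Definition regular_toeplitz (R : realType) (x : biseq) : Prop :=
  sup [set density R (per p x) | p in [set p : nat | (0 < p)%N]] = 1.

Definition irregular_toeplitz (R : realType) (x : biseq) : Prop :=
  toeplitz x /\ ~ regular_toeplitz R x.

(* A Borel probability measure on a closed set X is represented by its
   extension by 0, i.e. by a Borel probability measure on {0,1}^Z that gives
   X full mass. *)
Definition invariant_on (R : realType) (X : set biseq)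
    (mu : probability biseq R) : Prop :=
  mu X = 1%E /\
  forall A : set biseq, measurable A -> mu (left_shift @^-1` A) = mu A.

Definition weak_cvg (R : realType) (mu_ : nat -> {measure set biseq -> \bar R})
    (mu : {measure set biseq -> \bar R}) : Prop :=
  forall f : biseq -> R, continuous f ->
    (\int[mu_ i]_x (f x)%:E)%E @[i --> \oo] --> (\int[mu]_x (f x)%:E)%E.

(* N^-1 \sum_(1 <= n <= N) \d_(S^n x) *)
Definition empirical (R : realType) (x : biseq) (N : nat) :
    {measure set biseq -> \bar R} :=
  mscale (N%:R^-1)%:nng (msum (fun n => \d_(iter n.+1 left_shift x)) N).

Definition generic (R : realType) (x : biseq) (mu : probability biseq R) :
    Prop :=
  weak_cvg (empirical R x) mu.

Definition quasi_generic (R : realType) (x : biseq) (mu : probability biseq R) :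
    Prop :=
  exists2 N_ : nat -> nat, increasing_seq N_ &
    weak_cvg (fun i => empirical R x (N_ i)) mu.

Definition mirsky (R : realType) (B : set nat) (mu : probability biseq R) :
    Prop :=
  invariant_on (orbit_closure (eta B)) mu /\
  forall N_ : nat -> nat, increasing_seq N_ ->
    freq R (multiples B) (N_ i) @[i --> \oo] -->
      lower_density R (multiples B) ->
    weak_cvg (fun i => empirical R (eta B) (N_ i)) mu.

Section entropy.
Context {d : measure_display} {T : measurableType d} {R : realType}.
Variables (mu : probability T R) (f : T -> T).

Definition finite_partition (k : nat) (P : 'I_k -> set T) : Prop :=
  [/\ forall i, measurable (P i), trivIset setT P & \bigcup_i P i = setT].

(* The cells of the join of the partitions f^-j P, 0 <= j < n, are indexed by
   the itineraries w of length n; some of them may be empty. *)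
Definition join_cell (k : nat) (P : 'I_k -> set T) (n : nat)
    (w : {ffun 'I_n -> 'I_k}) : set T :=
  [set x | forall j : 'I_n, P (w j) (iter j f x)].

(* Shannon entropy of the join; [0 * ln 0 = 0]. *)
Definition join_entropy (k : nat) (P : 'I_k -> set T) (n : nat) : R :=
  - \sum_(w : {ffun 'I_n -> 'I_k})
      let t := fine (mu (join_cell P w)) in t * ln t.

Definition partition_entropy (k : nat) (P : 'I_k -> set T) : R :=
  limn (fun n => n%:R^-1 * join_entropy P n).

Definition ks_entropy : \bar R :=
  ereal_sup [set h : \bar R | exists k (P : 'I_k -> set T),
    finite_partition P /\ h = (partition_entropy P)%:E].

End entropy.

Definition has_positive_entropy (R : realType) (mu : probability biseq R) :
    Prop :=
  (0 < ks_entropy mu left_shift)%E.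

(* Main.v *)
(* Let P_i be a finite set of primes beyond 2^(i+12) whose reciprocals have a
   sum lam_i >= 2^(i+12), and call x rich at level i if it has at least
   (3/4) lam_i divisors in P_i. By Turan's variance bound all but a proportion
   16/lam_i of the integers are rich. Stage k of the construction works with a
   period Q_k (a factorial divisible by everything used before) and an
   interval [T_k, E_k) of 2^(Q_k) periods, where T_k = c_k (E_k - T_k). Among
   the integers T_k + j Q_k + z (j < 2^(Q_k), z < Q_k) which are rich at the
   levels up to k, the set B receives those for which the binary digit of j at
   position z is 1.
   - A multiple am of an element a of stage k either has unusually many prime
     divisors in P_k, or many squares of primes of P_k divide it, or m has
     unusually few prime divisors in P_k. So, as in Besicovitch's theorem, the
     multiples of stage k have small density, although stage k may fill a
     positive proportion of [1, E_k]. Hence at least 15/16 of the residues z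
     mod Q_k are free at stage k, and there eta is the negation of the digit.
   - Elements of stage k have a divisor in each P_i, i <= k. Hence, if n is free,
     so is n + pZ for p the product of P_|n| and of the elements of the first
     |n| stages, and eta is Toeplitz. Digits vary, so the free residues belong to
     no Per_p with p | Q_k, and eta is irregular.
   - Limits of empirical measures along windows containing [T_k, E_k) in a
     proportion at least 1/2 have positive entropy: the digits run through all
     configurations on the free residues, and entropy is concave.
   - With c_k = 1 the frequency of multiples oscillates, being small at T_k and
     at least 15/64 at E_k. With c_k = 2^k the sum of 1/b over B converges, so
     eta is approximated by periodic sequences and is generic. *)
From HB Require Import structures.
Require Import Defs.
From mathcomp Require Import all_boot all_order all_algebra.
From mathcomp Require Import all_classical all_reals all_analysis.
From mathcomp Require Import measurable_realfun.
From mathcomp Require Import zify ring lra.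

Set Implicit Arguments.
Unset Strict Implicit.
Unset Printing Implicit Defensive.

Import Order.TTheory GRing.Theory Num.Theory.
Import numFieldNormedType.Exports.

Local Open Scope classical_set_scope.
Local Open Scope ring_scope.

(** * Counting and sums of reciprocals of primes *)

Section Counting.
Context {R : realType}.
Implicit Types (D E : pred nat) (N q d m n : nat).

Definition cnt D N : R := \sum_(0 <= x < N) (D x)%:R.

Lemma cnt_ge0 D N : 0 <= cnt D N.
Proof. by apply: sumr_ge0. Qed.

Lemma cnt_le D E N : (forall x, (x < N)%N -> D x -> E x) -> cnt D N <= cnt E N.
Proof.
move=> DE; apply: ler_sum_nat => x /andP[_ xN]; rewrite ler_nat.
by case: (D x) (DE x xN) => // ->.
Qed.

Lemma eq_cnt D E N : (forall x, (x < N)%N -> D x = E x) -> cnt D N = cnt E N.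
Proof. by move=> DE; apply: eq_big_nat => x /andP[_ xN]; rewrite DE. Qed.

Lemma cnt_predT N : cnt predT N = N%:R.
Proof. by rewrite /cnt sumr_const_nat subn0. Qed.

Lemma cnt_leN D N : cnt D N <= N%:R.
Proof. by rewrite -(cnt_predT N); exact: cnt_le. Qed.

Lemma cntC D N : cnt (predC D) N = N%:R - cnt D N.
Proof.
rewrite -(cnt_predT N) /cnt -sumrB; apply: eq_bigr => x _ /=.
by case: (D x); rewrite ?subr0 ?subrr.
Qed.

Lemma cntU D E N : cnt (predU D E) N <= cnt D N + cnt E N.
Proof.
rewrite /cnt -big_split; apply: ler_sum => x _ /=.
by rewrite -natrD ler_nat; case: (D x); case: (E x).
Qed.

Lemma cnt_has (I : Type) (s : seq I) (F : I -> pred nat) N :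
  cnt (fun x => has (F ^~ x) s) N <= \sum_(i <- s) cnt (F i) N.
Proof.
elim: s => [|i s IHs]; first by rewrite big_nil /cnt big1.
by rewrite big_cons (le_trans (cntU _ _ _)) // lerD2l.
Qed.

Lemma cntD D m n : cnt D (m + n) = cnt D m + cnt (fun x => D (m + x)%N) n.
Proof.
rewrite /cnt (big_cat_nat (n := m)) ?leq_addr //=; congr (_ + _).
rewrite -{1}(add0n m) big_addn addKn.
by apply: eq_bigr => i _; rewrite addnC.
Qed.

Lemma cnt_widen D m n : (m <= n)%N -> cnt D m <= cnt D n.
Proof. by move=> /subnKC <-; rewrite cntD lerDl cnt_ge0. Qed.

Lemma periodicM (T : Type) (f : nat -> T) q m x :
  (forall x, f (x + q)%N = f x) -> f (m * q + x)%N = f x.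
Proof.
move=> fq; elim: m => [|m IHm]; first by rewrite mul0n.
by rewrite mulSn -addnA addnC fq.
Qed.

Lemma cnt_periodic D q m :
  (forall x, D (x + q)%N = D x) -> cnt D (m * q) = m%:R * cnt D q.
Proof.
move=> Dq; elim: m => [|m IHm]; first by rewrite mul0n mul0r /cnt big_nil.
rewrite mulSn addnC cntD IHm -natr1 mulrDl mul1r; congr (_ + _).
by apply: eq_cnt => x _; rewrite periodicM.
Qed.

Lemma cnt_dvd_div D d m : (0 < d)%N ->
  cnt (fun x => (d %| x) && D (x %/ d))%N (m * d) = cnt D m.
Proof.
move=> d0; elim: m => [|m IHm]; first by rewrite mul0n /cnt !big_nil.
rewrite mulSn addnC cntD IHm -addn1 cntD; congr (_ + _).
rewrite /cnt big_nat1 -{1}(prednK d0) big_nat_recl //= big_nat big1.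
  by rewrite addr0 !addn0 dvdn_mull //= mulnK.
move=> i /andP[_ iLd].
rewrite dvdn_addr ?dvdn_mull // gtnNdvd //; lia.
Qed.

Lemma cnt_dvd d N : (0 < d)%N -> (d %| N)%N -> cnt (dvdn d) N = N%:R / d%:R.
Proof.
move=> d0 /dvdnP[m ->].
rewrite (_ : cnt _ _ = cnt (fun x => (d %| x) && predT (x %/ d))%N (m * d)).
  by rewrite cnt_dvd_div // cnt_predT natrM mulfK // pnatr_eq0 -lt0n.
by apply: eq_cnt => x _; rewrite /= andbT.
Qed.

Lemma cnt_dvd_le d N : (0 < d)%N ->
  cnt (fun x => (0 < x) && (d %| x))%N N.+1 <= N%:R / d%:R.
Proof.
move=> d0; rewrite ler_pdivlMr ?ltr0n //.
rewrite /cnt big_nat_recl //= add0r.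
rewrite -natr_sum -natrM ler_nat.
have -> : (\sum_(0 <= i < N) (d %| i.+1) = N %/ d)%N.
  by rewrite divn_count_dvd big_add1.
exact: leq_trunc_div.
Qed.

Lemma cnt_markov (f : nat -> R) (t : R) N : (forall x, 0 <= f x) ->
  cnt (fun x => t <= f x) N * t <= \sum_(0 <= x < N) f x.
Proof.
move=> f0; rewrite /cnt mulr_suml; apply: ler_sum => x _.
by case: (boolP (t <= f x)) => tf; rewrite ?mul1r ?mul0r.
Qed.

End Counting.

(** * Turan's variance bound for the number of prime divisors in a finite set *)

Section PrimeCount.
Context {R : realType}.
Variable P : seq nat.
Hypothesis P_prime : forall p, p \in P -> prime p.
Hypothesis P_uniq : uniq P.
Notation cnt := (@cnt R).

Definition omega (x : nat) : R := \sum_(p <- P) (p %| x)%N%:R.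
Definition prime_mass : R := \sum_(p <- P) p%:R^-1.
Notation lam := prime_mass.

Lemma prime_mass_ge0 : 0 <= lam.
Proof. by apply: sumr_ge0 => p _; rewrite invr_ge0. Qed.

Variable N : nat.
Hypothesis PN : forall p q, p \in P -> q \in P -> (p * q %| N)%N.

Let p0 p : p \in P -> (0 < p)%N. Proof. by move/P_prime/prime_gt0. Qed.

Let cntP p : p \in P -> cnt (dvdn p) N = N%:R / p%:R.
Proof.
move=> pP; apply: cnt_dvd; first exact: p0.
by apply: dvdn_trans (PN pP pP); exact: dvdn_mulr.
Qed.

Lemma sum_omega : \sum_(0 <= x < N) omega x = N%:R * lam.
Proof.
rewrite /omega exchange_big /= mulr_sumr; apply: eq_big_seq => p pP.
exact: cntP.
Qed.

(** Since every product [p * q] divides [N], the counts carry no rounding errors: distinct primes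
    contribute [N / (p * q)], and the diagonal terms [N / p] add up to [N * lam]. *)
Lemma sum_omega2 :
  \sum_(0 <= x < N) omega x ^+ 2 <= N%:R * lam ^+ 2 + N%:R * lam.
Proof.
have -> : \sum_(0 <= x < N) omega x ^+ 2 =
  \sum_(p <- P) \sum_(q <- P) cnt (fun x => (p %| x) && (q %| x))%N N.
  under eq_bigr do rewrite expr2 /omega mulr_suml.
  rewrite exchange_big /=; apply: eq_bigr => p _.
  under eq_bigr do rewrite mulr_sumr.
  rewrite exchange_big /=; apply: eq_bigr => q _.
  by apply: eq_bigr => x _; rewrite -natrM mulnb.
have step p q : p \in P -> q \in P ->
    cnt (fun x => (p %| x) && (q %| x))%N N <=
    N%:R * (p%:R^-1 * q%:R^-1) + (q == p)%:R * (N%:R * p%:R^-1).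
  move=> pP qP; case: (eqVneq q p) => [->|qp].
    rewrite mul1r -{1}(cntP pP) (le_trans (cnt_le (E := dvdn p) _)) //.
      by move=> x _ /andP[].
    by rewrite lerDr mulr_ge0// mulr_ge0// invr_ge0.
  rewrite mul0r addr0 -invfM -natrM -cnt_dvd ?muln_gt0 ?p0 ?PN //.
  apply: cnt_le => x _ /andP[px qx]; rewrite Gauss_dvd ?px //.
  by rewrite prime_coprime ?P_prime // dvdn_prime2 ?P_prime // eq_sym.
have : \sum_(p <- P) \sum_(q <- P)
    (N%:R * (p%:R^-1 * q%:R^-1) + (q == p)%:R * (N%:R * p%:R^-1)) =
    N%:R * lam ^+ 2 + N%:R * lam :> R.
  under eq_bigr do rewrite big_split /= -mulr_sumr -mulr_sumr -mulr_suml.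
  rewrite big_split /= -mulr_sumr -mulr_suml -expr2; congr (_ + _).
  rewrite mulr_sumr; apply: eq_big_seq => p pP.
  by rewrite (bigD1_seq p) //= eqxx big1 ?addr0 ?mul1r // => q /negPf ->.
move=> <-; rewrite big_seq [leRHS]big_seq; apply: ler_sum => p pP.
rewrite big_seq [leRHS]big_seq; apply: ler_sum => q qP; exact: step.
Qed.

Lemma turan : \sum_(0 <= x < N) (omega x - lam) ^+ 2 <= N%:R * lam.
Proof.
have -> : \sum_(0 <= x < N) (omega x - lam) ^+ 2 =
    \sum_(0 <= x < N) omega x ^+ 2 - 2 * lam * \sum_(0 <= x < N) omega x
    + N%:R * lam ^+ 2.
  have -> : N%:R * lam ^+ 2 = \sum_(0 <= x < N) lam ^+ 2.
    by rewrite sumr_const_nat subn0 mulr_natl.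
  rewrite mulr_sumr -sumrB.
  by rewrite -big_split; apply: eq_bigr => x _ /=; ring.
by rewrite sum_omega; have := sum_omega2; lra.
Qed.

(** Chebyshev's inequality for the variance bounded in [turan]. *)
Lemma omega_deviation (D : pred nat) (t : R) : 0 < t ->
  (forall x, D x -> t ^+ 2 <= (omega x - lam) ^+ 2) ->
  cnt D N <= lam / t ^+ 2 * N%:R.
Proof.
move=> t0 Dt; rewrite mulrAC ler_pdivlMr ?exprn_gt0 // mulrC.
apply: (le_trans _ (le_trans turan _)); last by rewrite mulrC.
apply: le_trans (cnt_markov (t ^+ 2) _ (fun x => sqr_ge0 (omega x - lam))).
by rewrite [leLHS]mulrC ler_wpM2r ?sqr_ge0 // cnt_le // => x _ /Dt.
Qed.

End PrimeCount.

(** * Besicovitch-type bound for the density of multiples *)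

Section MultiplesBound.
Context {R : realType}.
Variable P : seq nat.
Hypothesis P_prime : forall p, p \in P -> prime p.
Hypothesis P_uniq : uniq P.
Notation cnt := (@cnt R).
Notation omega := (@omega R P).
Notation lam := (@prime_mass R P).

(** A prime dividing both [a] and [m] is counted twice on the left; its square then divides [a * m],
    and the last sum makes up for it. *)
Lemma omegaD a m :
  omega a + omega m <= omega (a * m) + \sum_(p <- P) (p ^ 2 %| a * m)%N%:R.
Proof.
rewrite /omega -!big_split /= big_seq [leRHS]big_seq; apply: ler_sum => p pP.
rewrite -!natrD ler_nat; have pp := P_prime pP.
rewrite Euclid_dvdM //; case: (boolP (p %| a)%N) => pa /=; last by lia.
case: (boolP (p %| m)%N) => pm /=; last by lia.
by rewrite -mulnn dvdn_mul.
Qed.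

(* For a dividing x = a * m, either x has many prime factors in P, or many
   of their squares divide x, or m has few prime factors in P. *)
Lemma multiples_bound (A : seq nat) (K T N : nat) : (0 < K)%N -> (0 < T)%N ->
  0 < lam -> (size A <= T)%N -> (forall p, p \in P -> (K <= p)%N) ->
  (forall a, a \in A -> (T <= a)%N /\ 3 / 4 * lam <= omega a) ->
  (forall p q, p \in P -> q \in P -> (p * q %| N)%N) ->
  (forall a p q, a \in A -> p \in P -> q \in P -> (a * (p * q) %| N)%N) ->
  cnt (fun x => has (dvdn^~ x) A) N <= (68 / lam + 8 / K%:R) * N%:R.
Proof.
move=> K0 T0 lam0 sA PK AT PN APN.
pose D1 x := 9 / 8 * lam <= omega x.
pose D2 x := lam / 8 <= \sum_(p <- P) (p ^ 2 %| x)%N%:R.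
pose D3 a x := (a %| x)%N && (omega (x %/ a)%N <= lam / 2).
have [p0 p0P] : exists p, p \in P.
  case EP : P lam0 => [|p s]; first by rewrite /prime_mass big_nil ltxx.
  by exists p; rewrite mem_head.
have b1 : cnt D1 N <= 64 / lam * N%:R.
  have -> : 64 / lam = lam / (lam / 8) ^+ 2 by field; rewrite gt_eqF.
  apply: (omega_deviation P_prime P_uniq PN); first by rewrite divr_gt0.
  by move=> x Dx; rewrite ler_pXn2r ?nnegrE //; move: Dx lam0; rewrite /D1; lra.
have b2 : cnt D2 N <= 8 / K%:R * N%:R.
  (* Markov's inequality; the sum of [1 / p ^ 2] over [P] is at most [lam / K]. *)
  have: cnt D2 N * (lam / 8) <= N%:R * (lam / K%:R).
    apply: le_trans (cnt_markov _ _ _) _; first by move=> x; exact: sumr_ge0.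
    rewrite exchange_big /= mulrA [N%:R * lam]mulrC -mulrA mulr_suml.
    rewrite big_seq [leRHS]big_seq; apply: ler_sum => p pP.
    have p_gt0 : (0 < p)%N by rewrite prime_gt0 // P_prime.
    rewrite [X in X <= _](@cnt_dvd _ (p ^ 2)) ?expn_gt0 ?p_gt0 ?PN //.
    rewrite natrX expr2 invfM [leLHS]mulrA [leLHS]mulrC; apply: ler_wpM2l.
      by rewrite invr_ge0.
    by apply: ler_wpM2l => //; rewrite lef_pV2 ?posrE ?ltr0n // ler_nat PK.
  have K1 : 0 < K%:R :> R by rewrite ltr0n.
  rewrite -ler_pdivlMr ?divr_gt0 // => /le_trans; apply.
  by rewrite le_eqVlt; apply/orP; left; apply/eqP; field; rewrite !gt_eqF.
(* With [N = M * a], the multiples of [a] below [N] correspond to the [m < M], and the variance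
   bound applies to [M <= N / T]. The factor [1 / T] pays for summing over the at most [T] elements
   of [A]. *)
have b3 a : a \in A -> cnt (D3 a) N <= 4 / lam * N%:R / T%:R.
  move=> aA; have [Ta _] := AT _ aA; have a0 : (0 < a)%N by lia.
  have /dvdnP[M NM] : (a %| N)%N.
    by apply: dvdn_trans (APN _ _ _ aA p0P p0P); exact: dvdn_mulr.
  rewrite NM [cnt _ _](@cnt_dvd_div R (fun m => omega m <= lam / 2)) //.
  apply: (@le_trans _ _ (4 / lam * M%:R)).
    have -> : 4 / lam = lam / (lam / 2) ^+ 2 by field; rewrite gt_eqF.
    apply: (omega_deviation P_prime P_uniq).
    - move=> p1 q pP1 qP; have := APN _ _ _ aA pP1 qP.
      by rewrite NM [(M * a)%N]mulnC dvdn_pmul2l.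
    - by rewrite divr_gt0.
    - move=> x Dx; rewrite -[leRHS]sqrrN ler_pXn2r ?nnegrE //; move: lam0 Dx; lra.
  rewrite natrM -[leRHS]mulrA -[X in _ <= _ * X]mulrA.
  apply: ler_wpM2l; first by rewrite divr_ge0 // ltW.
  by apply: ler_peMr => //; rewrite ler_pdivlMr ?ltr0n // mul1r ler_nat.
(* If [D1] and [D2] fail at [x = a * m], then [omegaD] gives [omega m < (9/8 + 1/8 - 3/4) * lam =
   lam / 2]. *)
have sub x : has (dvdn^~ x) A -> D1 x || D2 x || has (D3 ^~ x) A.
  case/hasP => a aA ax; apply: contraT; rewrite !negb_or -!ltNge.
  move=> /andP[/andP[d1 d2] /hasPn d3]; have := d3 _ aA.
  rewrite /D3 ax /= -ltNge; have [_] := AT _ aA; move/dvdnP: ax => [m xE].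
  have -> : (x %/ a)%N = m by rewrite xE mulnK //; have [+ _] := AT _ aA; lia.
  by have := omegaD a m; rewrite mulnC -xE; move: d1 d2; lra.
apply: le_trans (cnt_le (fun x _ => sub x)) _.
apply: le_trans (cntU (predU D1 D2) _ _) _.
apply: le_trans (lerD (cntU _ _ _) (cnt_has _ _ _)) _.
have b4 : \sum_(a <- A) cnt (D3 a) N <= 4 / lam * N%:R.
  apply: (@le_trans _ _ (\sum_(a <- A) (4 / lam * N%:R / T%:R))).
    by rewrite big_seq [leRHS]big_seq; apply: ler_sum.
  rewrite big_const_seq count_predT iter_addr addr0.
  rewrite -[leLHS]mulr_natr -[leLHS]mulrA.
  apply: ler_piMr; first by rewrite mulr_ge0 // divr_ge0 // ltW.
  by rewrite mulrC ler_pdivrMr ?ltr0n // mul1r ler_nat.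
apply: le_trans (lerD (lerD b1 b2) b4) _.
by rewrite le_eqVlt; apply/orP; left; apply/eqP; ring.
Qed.

End MultiplesBound.

(** * Divergence of the sum of the reciprocals of the primes *)

Section PrimeReciprocals.
Context {R : realType}.

Definition primes_in (K u : nat) : seq nat :=
  [seq p <- iota K.+1 (u - K) | prime p].

Lemma mem_primes_in K u p :
  (p \in primes_in K u) = [&& prime p, K < p & p <= u]%N.
Proof.
rewrite mem_filter mem_iota; case: (prime p) => //=; lia.
Qed.

Lemma primes_in_uniq K u : uniq (primes_in K u).
Proof. exact/filter_uniq/iota_uniq. Qed.

(* A number below 2 ^ n free of primes beyond K is determined by its
   valuations at the numbers up to K, each at most n. *)
Lemma card_smooth (K n N : nat) : (N <= 2 ^ n)%N ->
  (\sum_(1 <= x < N.+1) all (fun p => p <= K) (primes x) <=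
    n.+1 ^ K.+1)%N.
Proof.
move=> N2; pose S := [seq x <- iota 1 N | all (fun p => p <= K)%N (primes x)].
have -> : (\sum_(1 <= x < N.+1) all (fun p => p <= K) (primes x) = size S)%N.
  rewrite size_filter -sum1_count [RHS]big_mkcond /index_iota subn1 /=.
  by apply: eq_bigr => x _; case: (all _ _).
pose f (x : nat) : {ffun 'I_K.+1 -> 'I_n.+1} := [ffun p : 'I_K.+1 => inord (logn p x)].
have logn_n x p : x \in S -> (logn p x < n.+1)%N.
  rewrite mem_filter mem_iota => /andP[_ /andP[x0 xN]].
  have : (2 ^ logn p x <= 2 ^ n)%N.
    apply: leq_trans N2; apply: (@leq_trans x); last by lia.
    case: (posnP (logn p x)) => [->|]; first by rewrite expn0.
    move=> l0; move: (l0); rewrite logn_gt0 mem_primes => /andP[/prime_gt1 p1 _].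
    apply: leq_trans (dvdn_leq x0 (pfactor_dvdnn p x)).
    by rewrite leq_exp2r.
  by rewrite leq_exp2l.
have finj : {in S &, injective f}.
  move=> x y xS yS /ffunP fxy.
  have [x0 y0] : (0 < x)%N /\ (0 < y)%N.
    by move: xS yS; rewrite !mem_filter !mem_iota; lia.
  apply: eqn_from_log => // p.
  case: (leqP p K) => pK.
    have := fxy (inord p); rewrite !ffunE inordK // => /(congr1 val) /=.
    by rewrite !inordK ?logn_n.
  have big z : z \in S -> logn p z = 0%N.
    rewrite mem_filter => /andP[/allP zK _]; apply/eqP; rewrite -leqn0 leqNgt.
    by rewrite logn_gt0; apply: contraL pK => /zK; rewrite -leqNgt.
  by rewrite !big.
have US : uniq S by exact/filter_uniq/iota_uniq.
rewrite -(size_map f); apply: leq_trans (_ : #|{ffun 'I_K.+1 -> 'I_n.+1}| <= _)%N.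
  rewrite cardE; apply: uniq_leq_size; first by rewrite map_inj_in_uniq.
  by move=> z _; rewrite mem_enum.
by rewrite card_ffun !card_ord.
Qed.

(** Otherwise fewer than half of the integers in [1, N] have a prime divisor beyond [K], so more
    than half have none. By [card_smooth] at most [n.+1 ^ M] have none, which is too few for
    [N = 2 ^ n] with [n = 2 ^ (4 * M)]. *)
Lemma prime_mass_ge_half (K : nat) :
  exists u, 1 / 2 <= prime_mass (primes_in K u) :> R.
Proof.
pose M := K.+1; pose n := (2 ^ (4 * M))%N; pose N := (2 ^ n)%N.
exists N; rewrite leNgt; apply/negP => lt2.
have N0 : (0 < N)%N by rewrite expn_gt0.
have key : (2 * n.+1 ^ M <= N)%N.
  have n1 : (n.+1 <= 2 ^ (4 * M).+1)%N.
    by rewrite expnS mul2n -addnn -addn1 leq_add2l expn_gt0.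
  rewrite /N; apply: (@leq_trans (2 * (2 ^ (4 * M).+1) ^ M)).
    by rewrite leq_pmul2l // leq_exp2r.
  rewrite -expnM -expnS leq_exp2l // /n mulnC expnM.
  have : (M.+1 <= 2 ^ M)%N by exact: ltn_expl.
  set t := (2 ^ M)%N => Mt; have -> : ((2 ^ 4) ^ M = t ^ 4)%N.
    by rewrite -!expnM mulnC.
  have -> : (t ^ 4 = t ^ 2 * t ^ 2)%N by rewrite -expnD.
  have : (M.+1 ^ 2 <= t ^ 2)%N by rewrite leq_exp2r.
  rewrite -!mulnn; nia.
have small : (N%:R < 2 * (\sum_(1 <= x < N.+1)
    all (fun p => p <= K)%N (primes x))%:R :> R).
  have : N%:R <= (\sum_(1 <= x < N.+1) all (fun p => p <= K) (primes x))%N%:R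
      + \sum_(p <- primes_in K N) N%:R / p%:R :> R.
    rewrite [leLHS](_ : _ = (\sum_(1 <= x < N.+1) 1)%N%:R); last first.
      by rewrite sum_nat_const_nat muln1 subn1.
    rewrite !natr_sum.
    apply: (@le_trans _ _ (\sum_(1 <= x < N.+1)
      ((all (fun p => p <= K) (primes x))%N%:R +
       \sum_(p <- primes_in K N) (p %| x)%N%:R))).
      apply: ler_sum_nat => x /andP[x0 xN].
      case: (boolP (all _ _)) => [_|/allPn[p]] /=.
        by rewrite lerDl sumr_ge0.
      rewrite mem_primes -ltnNge => /and3P[pp _ px] Kp.
      rewrite add0r (bigD1_seq p) ?primes_in_uniq //=; last first.
        by rewrite mem_primes_in pp Kp (leq_trans (dvdn_leq _ px)).
      by rewrite px lerDl sumr_ge0.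
    rewrite big_split lerD2l exchange_big /=; apply: ler_sum => p _.
    rewrite -natr_sum -divn_count_dvd.
    case: (posnP p) => [->|p0]; first by rewrite divn0 mulr_ge0.
    by rewrite ler_pdivlMr ?ltr0n // -natrM ler_nat leq_trunc_div.
  have N0R : 0 < N%:R :> R by rewrite ltr0n.
  by rewrite -mulr_sumr; move: lt2; rewrite /prime_mass => lt2; nra.
have := card_smooth K (leqnn N).
by move: small; rewrite -natrM ltr_nat; move: key; rewrite -/M; lia.
Qed.

Lemma prime_mass_cat K u v : (K <= u <= v)%N ->
  prime_mass (primes_in K v) =
  prime_mass (primes_in K u) + prime_mass (primes_in u v) :> R.
Proof.
move=> /andP[Ku uv]; rewrite /prime_mass /primes_in -big_cat -filter_cat.
have -> : (v - K = (u - K) + (v - u))%N by lia.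
by rewrite iotaD; have -> : (K.+1 + (u - K) = u.+1)%N by lia.
Qed.

Lemma prime_mass_diverges (K : nat) (L : R) :
  exists u, L <= prime_mass (primes_in K u).
Proof.
suff H n : exists2 u, (K <= u)%N & n%:R / 2 <= prime_mass (primes_in K u) :> R.
  have [u _ Hu] := H (Num.trunc (2 * `|L|)).+1.
  exists u; apply: le_trans Hu; rewrite ler_pdivlMr //.
  apply: (@le_trans _ _ (2 * `|L|)); first by rewrite mulrC ler_pM2l ?ler_norm.
  by rewrite ltW // truncnS_gt.
elim: n => [|n [u Ku IHn]].
  by exists K => //; rewrite mul0r prime_mass_ge0.
have [v v2] := prime_mass_ge_half u; exists (maxn u v); first by lia.
rewrite (prime_mass_cat (u := u)) ?Ku ?leq_maxl //.
have -> : maxn u v = v.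
  (* If [v <= u], then [primes_in u v] is empty and its mass is 0, not at least 1/2. *)
  rewrite /maxn; case: ltnP => // vu; exfalso; move: v2.
  have -> : primes_in u v = [::] by rewrite /primes_in (eqP vu).
  by rewrite /prime_mass big_nil; lra.
by rewrite -natr1; move: IHn v2; lra.
Qed.

End PrimeReciprocals.

(** * Counting integers with prescribed binary digits *)

Section Digits.
Context {R : realType}.

Definition bit (j z : nat) : bool := odd (j %/ 2 ^ z).

Lemma bit0n z : bit 0 z = false.
Proof. by rewrite /bit div0n. Qed.

Lemma bit_exp2 z : bit (2 ^ z) z.
Proof. by rewrite /bit divnn expn_gt0. Qed.

Lemma bit_ltn n j : (j < 2 ^ n)%N -> bit j n = false.
Proof. by move=> jn; rewrite /bit divn_small. Qed.

Lemma bitD_exp2_same n j : (j < 2 ^ n)%N -> bit (2 ^ n + j) n.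
Proof.
by move=> jn; rewrite /bit divnDl // divnn expn_gt0 divn_small.
Qed.

Lemma bitD_exp2 n z j : (z < n)%N -> bit (2 ^ n + j) z = bit j z.
Proof.
move=> zn; rewrite /bit divnDl ?dvdn_exp2l 1?ltnW //.
rewrite oddD -expnB // 1?ltnW // oddX /= orbF.
by rewrite subn_eq0 leqNgt zn.
Qed.

Definition digits_match (Y g : pred nat) (n j : nat) : bool :=
  all (fun z => Y z ==> (bit j z == g z)) (iota 0 n).

(** Induction on the top digit, which is 0 on the lower half of [0, 2^(n+1)) and 1 on the upper
    half. If position [n] is in [Y], exactly one half survives; otherwise both do. *)
Lemma cnt_digits_match (Y g : pred nat) n :
  @cnt R (digits_match Y g n) (2 ^ n) * 2 ^+ count Y (iota 0 n) = 2 ^+ n.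
Proof.
have dmS m j : digits_match Y g m.+1 j =
    digits_match Y g m j && (Y m ==> (bit j m == g m)).
  by rewrite /digits_match -addn1 iotaD all_cat /= andbT.
elim: n => [|n IHn]; first by rewrite /cnt big_nat1 mulr1.
rewrite -{3}addn1 iotaD count_cat /= addn0 expnS mul2n -addnn cntD.
have lo : cnt (digits_match Y g n.+1) (2 ^ n) =
    (Y n ==> ~~ g n)%:R * cnt (digits_match Y g n) (2 ^ n) :> R.
  rewrite /cnt mulr_sumr; apply: eq_big_nat => j /andP[_ jn].
  by rewrite dmS bit_ltn // -natrM mulnb andbC; case: (g n).
have hi : cnt (fun j => digits_match Y g n.+1 (2 ^ n + j)) (2 ^ n) =
    (Y n ==> g n)%:R * cnt (digits_match Y g n) (2 ^ n) :> R.
  rewrite /cnt mulr_sumr; apply: eq_big_nat => j /andP[_ jn].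
  rewrite dmS bitD_exp2_same // -natrM mulnb andbC eq_sym eqb_id.
  congr (_ && _)%:R.
  rewrite /digits_match; apply: eq_in_all => z; rewrite mem_iota => /= zn.
  by rewrite bitD_exp2.
rewrite lo hi exprS -IHn exprD.
by case: (Y n); case: (g n); rewrite /= ?expr1 ?expr0; ring.
Qed.

Lemma cnt_bit n z : (z < n)%N -> @cnt R (bit ^~ z) (2 ^ n) = 2 ^+ n / 2.
Proof.
move=> zn; have := cnt_digits_match (pred1 z) predT n.
have -> : count (pred1 z) (iota 0 n) = 1%N.
  by rewrite count_uniq_mem ?iota_uniq // mem_iota zn.
move=> <-; rewrite expr1 mulfK ?pnatr_eq0 //; apply: eq_cnt => j _.
apply/idP/allP => [jz x _|/(_ z)]; first by apply/implyP => /eqP ->; rewrite jz.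
by rewrite mem_iota /= eqxx /= eqb_id; apply.
Qed.

Lemma cnt_blocks (D : pred nat) m q :
  cnt D (m * q) = \sum_(0 <= j < m) @cnt R (fun z => D (j * q + z)%N) q.
Proof.
elim: m => [|m IHm]; first by rewrite mul0n big_nil /cnt big_nil.
by rewrite mulSn addnC cntD IHm big_nat_recr.
Qed.

End Digits.

(** * Lower and upper densities *)

Section Densities.
Context {R : realType}.
Variables (M : set int).
Notation freq := (@freq R M).

Lemma freqE N :
  freq N = N%:R^-1 * cnt (fun n => (0 < n)%N && (n%:Z \in M)) N.+1.
Proof.
rewrite /freq /cnt natr_sum; congr (_ * _).
by rewrite [RHS]big_nat_recl //= add0r big_add1.
Qed.

Lemma freq_ge0 N : 0 <= freq N.
Proof. by rewrite freqE mulr_ge0 ?invr_ge0 ?cnt_ge0. Qed.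

Lemma freq_le_cnt (D : pred nat) N :
  (forall n, (0 < n <= N)%N -> n%:Z \in M -> D n) ->
  freq N <= N%:R^-1 * cnt D N.+1.
Proof.
move=> MD; rewrite freqE ler_wpM2l ?invr_ge0 //; apply: cnt_le => n.
by rewrite ltnS => nN /andP[n0]; apply: MD; rewrite n0 nN.
Qed.

Lemma freq_le1 N : freq N <= 1.
Proof.
case: (posnP N) => [->|N0]; first by rewrite freqE invr0 mul0r.
rewrite freqE mulrC ler_pdivrMr ?ltr0n // mul1r /cnt big_nat_recl //= add0r.
by rewrite -[leRHS](@cnt_predT R) /cnt; apply: ler_sum => x _; case: (_ \in _).
Qed.

Lemma freq_bounded : bounded_fun freq.
Proof.
exists 1; split => // x x1 n _; rewrite /= ger0_norm ?freq_ge0 //.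
exact: le_trans (freq_le1 n) (ltW x1).
Qed.

Lemma lower_density_le (a : R) :
  (forall n0, exists2 n, (n0 <= n)%N & freq n <= a) -> lower_density R M <= a.
Proof.
move=> H; rewrite /lower_density (limn_infE freq_bounded).
apply: ge_sup; first by exists (infs freq 0); exists 0%N.
move=> _ [n _ <-]; have [k nk fa] := H n; apply: le_trans fa.
apply: ge_inf; first by exists 0 => _ [j _ <-]; exact: freq_ge0.
by exists k.
Qed.

Lemma upper_density_ge (a : R) :
  (forall n0, exists2 n, (n0 <= n)%N & a <= freq n) -> a <= upper_density R M.
Proof.
move=> H; rewrite /upper_density (limn_supE freq_bounded).
apply: lb_le_inf; first by exists (sups freq 0); exists 0%N.
move=> _ [n _ <-]; have [k nk fa] := H n; apply: le_trans fa _.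
apply: ub_le_sup; first by exists 1 => _ [j _ <-]; exact: freq_le1.
by exists k.
Qed.

Lemma cvg_has_density : cvgn freq -> has_density R M.
Proof.
by move=> cf; rewrite /has_density /lower_density /upper_density
  cvg_limn_infE // cvg_limn_supE.
Qed.

End Densities.

(** * The construction *)

Lemma omega_periodic (R : realType) (P : seq nat) (q x : nat) :
  (forall p, p \in P -> (p %| q)%N) -> omega P (x + q) = omega P x :> R.
Proof. by move=> Pq; apply: eq_big_seq => p /Pq pq; rewrite dvdn_addl. Qed.

(* The data P_k, Q_k and c_k = T_k / (E_k - T_k) of the construction. *)
Record stages (R : realType) := Stages {
  stage_primes : nat -> seq nat;
  stage_period : nat -> nat;
  stage_ratio : nat -> nat;
  stage_start k := (stage_ratio k * (2 ^ stage_period k * stage_period k))%N;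
  stage_end k := (stage_start k + 2 ^ stage_period k * stage_period k)%N;
  stage_prime : forall i p, p \in stage_primes i -> prime p;
  stage_uniq : forall i, uniq (stage_primes i);
  stage_large : forall i p, p \in stage_primes i -> (2 ^ (i + 12) <= p)%N;
  stage_mass : forall i, (2 ^ (i + 12))%:R <= prime_mass (stage_primes i) :> R;
  stage_period_gt0 : forall k, (0 < stage_period k)%N;
  stage_ratio_gt0 : forall k, (0 < stage_ratio k)%N;
  stage_primes_dvd : forall i k p q, (i <= k)%N ->
    p \in stage_primes i -> q \in stage_primes i -> (p * q %| stage_period k)%N;
  stage_elems_dvd : forall i k a p q, (i < k)%N -> (0 < a < stage_end i)%N ->
    p \in stage_primes i -> q \in stage_primes i ->
    (a * (p * q) %| stage_period k)%N;
  stage_nat_dvd : forall n k, (0 < n <= k)%N -> (n %| stage_period k)%N;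
  stage_end_le : forall k, (stage_end k <= stage_period k.+1)%N
}.

Section Construction.
Context {R : realType}.
Variable S : stages R.
Notation P := (stage_primes S).
Notation Q := (stage_period S).
Notation T := (stage_start S).
Notation E := (stage_end S).
Notation mass i := (@prime_mass R (P i)).
Notation om i := (@omega R (P i)).
Notation cnt := (@cnt R).

Definition rich (i x : nat) : bool := 3 / 4 * mass i <= om i x.

Definition good (k x : nat) : bool := all (rich ^~ x) (iota 0 k.+1).

Definition stage_set (k : nat) : seq nat :=
  [seq b <- iota (T k) (2 ^ Q k * Q k) |
     good k b && bit ((b - T k) %/ Q k) (b %% Q k)].
Notation A := stage_set.

Definition stage_union : set nat := [set b | exists k, b \in A k].
Notation B := stage_union.

Definition old_multiple (k x : nat) : bool :=
  has (fun i => has (dvdn ^~ x) (A i)) (iota 0 k).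

(** All primes and elements involved divide [Q k], so this is a set of residues mod [Q k]. On it the
    value of [eta] in the window of stage [k] is decided by a digit alone ([eta_window]). *)
Definition free_residue (k x : nat) : bool := good k x && ~~ old_multiple k x.
Notation Z := free_residue.

Lemma mem_stage_set k b : (b \in A k) = [&& (T k <= b < E k)%N, good k b &
  bit ((b - T k) %/ Q k) (b %% Q k)].
Proof. by rewrite mem_filter mem_iota andbC. Qed.

Lemma size_stage_set k : (size (A k) <= 2 ^ Q k * Q k)%N.
Proof.
by rewrite size_filter (leq_trans (count_size _ _)) // size_iota.
Qed.

Lemma stage_width_le k : (2 ^ Q k * Q k <= T k)%N.
Proof. by rewrite leq_pmull // stage_ratio_gt0. Qed.

Lemma stage_width_gt1 k : (1 < 2 ^ Q k * Q k)%N.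
Proof.
have := stage_period_gt0 S k; have := ltn_expl (Q k) (isT : 1 < 2)%N.
by move: (2 ^ Q k)%N => t; nia.
Qed.

Lemma stage_start_gt1 k : (1 < T k)%N.
Proof. exact: leq_trans (stage_width_gt1 k) (stage_width_le k). Qed.

Lemma stage_period_le k : (Q k <= T k)%N.
Proof. by rewrite (leq_trans _ (stage_width_le k)) // leq_pmull // expn_gt0. Qed.

Lemma stage_start_lt_end k : (T k < E k)%N.
Proof. by rewrite -[X in (X < _)%N]addn0 ltn_add2l ltnW // stage_width_gt1. Qed.

Lemma stage_end_double k : (E k <= 2 * T k)%N.
Proof. by rewrite mul2n -addnn leq_add2l stage_width_le. Qed.

Lemma stage_end_start i k : (i < k)%N -> (E i <= T k)%N.
Proof.
elim: k => // k IHk; rewrite ltnS leq_eqVlt => /orP[/eqP ->|ik].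
  by rewrite (leq_trans (stage_end_le S k)) // stage_period_le.
rewrite (leq_trans (IHk ik)) // (leq_trans (ltnW (stage_start_lt_end k))) //.
by rewrite (leq_trans (stage_end_le S k)) // stage_period_le.
Qed.

Lemma stage_mass_gt0 i : 0 < mass i.
Proof. by apply: lt_le_trans (stage_mass S i); rewrite ltr0n expn_gt0. Qed.

Lemma stage_primes_neq0 i : exists p, p \in P i.
Proof.
have := stage_mass_gt0 i; case: (P i) => [|p s _].
  by rewrite /prime_mass big_nil ltxx.
by exists p; rewrite mem_head.
Qed.

Lemma stage_prime_dvd i k p : (i <= k)%N -> p \in P i -> (p %| Q k)%N.
Proof.
move=> ik pP; apply: dvdn_trans (stage_primes_dvd ik pP pP); exact: dvdn_mulr.
Qed.

Lemma stage_set_dvd i k a : (i < k)%N -> a \in A i -> (a %| Q k)%N.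
Proof.
move=> ik; rewrite mem_stage_set => /and3P[/andP[Ta aE] _ _].
have [p pP] := stage_primes_neq0 i.
apply: dvdn_trans (stage_elems_dvd (a := a) ik _ pP pP); first exact: dvdn_mulr.
by rewrite aE andbT; apply: leq_trans Ta; have := stage_start_gt1 i; lia.
Qed.

Lemma rich_periodic i k x : (i <= k)%N -> rich i (x + Q k) = rich i x.
Proof.
move=> ik; rewrite /rich omega_periodic // => p; exact: stage_prime_dvd.
Qed.

Lemma good_periodic k x : good k (x + Q k) = good k x.
Proof.
apply: eq_in_all => i; rewrite mem_iota => /= ik; exact: rich_periodic.
Qed.

Lemma old_multiple_periodic k x : old_multiple k (x + Q k) = old_multiple k x.
Proof.
apply: eq_in_has => i; rewrite mem_iota => /= ik.
by apply: eq_in_has => a aA; rewrite dvdn_addl // (stage_set_dvd ik).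
Qed.

Lemma free_residue_periodic k x : Z k (x + Q k) = Z k x.
Proof. by rewrite /free_residue good_periodic old_multiple_periodic. Qed.

Lemma free_residue_mod k x : Z k (x %% Q k) = Z k x.
Proof.
by rewrite [in RHS](divn_eq x (Q k)) (periodicM _ _ (free_residue_periodic k)).
Qed.

Lemma mem_multiples (n : int) :
  (n \in multiples B) <-> exists k, has (dvdn ^~ `|n|%N) (A k).
Proof.
rewrite in_setE; split => [[b [k bA]]|[k /hasP[b bA bn]]].
  by rewrite /= dvdzE => bn; exists k; apply/hasP; exists b.
by exists b; [exists k|rewrite /= dvdzE].
Qed.

(** The elements of stage [k] and later are at least [T k], hence too large to divide [x]. *)
Lemma multiple_before k (x : nat) : (0 < x < T k)%N ->
  (x%:Z \in multiples B) = old_multiple k x.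
Proof.
move=> /andP[x0 xT]; apply/idP/idP.
  move=> /mem_multiples[i] Aix; apply/hasP; exists i => //.
  rewrite mem_iota /= add0n; case: ltnP => // ki; exfalso.
  move/hasP: Aix => [b]; rewrite mem_stage_set => /and3P[/andP[Tb _] _ _].
  move/(dvdn_leq x0); apply/negP; rewrite -ltnNge.
  apply: leq_trans xT (leq_trans _ Tb); move: ki.
  rewrite leq_eqVlt => /orP[/eqP -> //|/stage_end_start].
  exact/leq_trans/ltnW/stage_start_lt_end.
by move=> /hasP[i _ Aix]; apply/mem_multiples; exists i.
Qed.

(** Elements of later stages exceed [x], and as [E k <= 2 * T k], the only multiple below [E k] of
    an element of stage [k] is the element itself. *)
Lemma multiple_within k (x : nat) : (T k <= x < E k)%N ->
  (x%:Z \in multiples B) = old_multiple k x || (x \in A k).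
Proof.
move=> /andP[Tx xE]; have x0 : (0 < x)%N by have := stage_start_gt1 k; lia.
apply/idP/orP.
  move=> /mem_multiples[i] Aix; case: (ltngtP i k) => ik.
  - by left; apply/hasP; exists i => //; rewrite mem_iota.
  - exfalso; move/hasP: Aix => [b].
    rewrite mem_stage_set => /and3P[/andP[Tb _] _ _].
    move/(dvdn_leq x0); apply/negP; rewrite -ltnNge.
    exact: leq_trans xE (leq_trans (stage_end_start ik) Tb).
  - right; move: Aix; rewrite ik => /hasP[b bA /dvdnP[m xm]].
    suff -> : x = b by [].
    move: bA; rewrite mem_stage_set => /and3P[/andP[Tb _] _ _].
    have := stage_end_double k; have := stage_start_gt1 k.
    have {}xm : x = (m * b)%N by [].
    by case: m xm => [|[|m]]; rewrite ?mulSn; lia.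
case=> [/hasP[i _ Aix]|xA]; apply/mem_multiples; first by exists i.
by exists k; apply/hasP; exists x.
Qed.

Lemma eta_multiples (n : int) : eta B n = ~~ (n \in multiples B).
Proof. by rewrite /eta /free_set in_setC. Qed.

Lemma window_lt k j z : (j < 2 ^ Q k)%N -> (z < Q k)%N ->
  (T k + (j * Q k + z) < E k)%N.
Proof.
move=> j2 zQ; rewrite ltn_add2l; apply: (@leq_trans (j.+1 * Q k)).
  by rewrite mulSn addnC ltn_add2r.
by rewrite leq_mul2r j2 orbT.
Qed.

(** [T k] is a multiple of [Q k], so the position has residue [z] and lies in block [j] of the
    window. *)
Lemma eta_window k j z : (j < 2 ^ Q k)%N -> (z < Q k)%N -> Z k z ->
  eta B (T k + (j * Q k + z))%N%:Z = ~~ bit j z.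
Proof.
move=> j2 zQ Zz; rewrite eta_multiples (@multiple_within k) ?leq_addr ?window_lt//.
have TQ : (T k + (j * Q k + z) = (stage_ratio S k * 2 ^ Q k + j) * Q k + z)%N.
  by rewrite mulnDl -mulnA addnA.
have /andP[gx /negPf mx] : Z k (T k + (j * Q k + z))%N.
  by rewrite TQ -free_residue_mod modnMDl free_residue_mod.
rewrite mx mem_stage_set gx window_lt // leq_addr addKn /=.
rewrite TQ modnMDl modn_small // divnMDl ?stage_period_gt0 //.
by rewrite divn_small // addn0.
Qed.

Lemma geometric_bound n :
  \sum_(i <- iota 0 n) (2 ^ (i + 12))%:R^-1 <= 2048^-1 :> R.
Proof.
suff -> : \sum_(i <- iota 0 n) (2 ^ (i + 12))%:R^-1 =
    2048^-1 - (2 ^ (n + 11))%:R^-1 :> R by rewrite gerBl invr_ge0.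
elim: n => [|n IHn]; first by rewrite big_nil; apply/esym/subrr.
rewrite -addn1 iotaD big_cat IHn /= big_seq1 add0n.
have -> : (n + 1 + 11 = (n + 11).+1)%N by lia.
have -> : (n + 12 = (n + 11).+1)%N by lia.
rewrite expnS natrM; have : (2 ^ (n + 11))%:R != 0 :> R.
  by rewrite pnatr_eq0 expn_eq0.
by move: (_ %:R) => t t0; field.
Qed.

(** An integer that is not rich deviates from the mean by at least [mass i / 4]. *)
Lemma cnt_not_rich i k m : (i <= k)%N ->
  cnt (predC (rich i)) (m * Q k) <=
  16 * (2 ^ (i + 12))%:R^-1 * (m * Q k)%N%:R.
Proof.
move=> ik; have m0 := stage_mass_gt0 i.
apply: (@le_trans _ _ (16 / mass i * (m * Q k)%N%:R)); last first.
  by rewrite ler_wpM2r // ler_pM2l // lef_pV2 ?posrE ?ltr0n ?expn_gt0 ?stage_mass.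
have -> : 16 / mass i = mass i / (mass i / 4) ^+ 2 by field; rewrite gt_eqF.
apply: (omega_deviation (@stage_prime _ S i) (stage_uniq S i)).
- by move=> p q pP qP; rewrite dvdn_mull // (stage_primes_dvd ik).
- by rewrite divr_gt0.
- move=> x; rewrite /= /rich -ltNge => xl.
  by rewrite -[leRHS]sqrrN ler_pXn2r ?nnegrE //; move: m0 xl; lra.
Qed.

(** [multiples_bound] with [K = 2 ^ (i + 12)], which is also a lower bound of [mass i]; 76 is 68 +
    8. *)
Lemma cnt_stage_multiple i k m : (i < k)%N ->
  cnt (fun x => has (dvdn ^~ x) (A i)) (m * Q k) <=
  76 * (2 ^ (i + 12))%:R^-1 * (m * Q k)%N%:R.
Proof.
move=> ik; have m0 := stage_mass_gt0 i.
have p0 : 0 < (2 ^ (i + 12))%:R :> R by rewrite ltr0n expn_gt0.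
apply: le_trans (multiples_bound (K := 2 ^ (i + 12)) (T := T i)
  (@stage_prime _ S i) (stage_uniq S i) _ _ m0 _ _ _ _ _) _.
- by rewrite expn_gt0.
- by have := stage_start_gt1 i; lia.
- exact: leq_trans (size_stage_set i) (stage_width_le i).
- exact: stage_large.
- move=> a; rewrite mem_stage_set => /and3P[/andP[Ta _] /allP ga _]; split=> //.
  by apply: (ga i); rewrite mem_iota /= add0n.
- by move=> p q pP qP; rewrite dvdn_mull // (stage_primes_dvd (ltnW ik)).
- move=> a p q aA pP qP; rewrite dvdn_mull // (stage_elems_dvd ik) //.
  move: aA; rewrite mem_stage_set => /and3P[/andP[Ta ->] _ _]; rewrite andbT.
  by apply: leq_trans Ta; have := stage_start_gt1 i; lia.
- rewrite ler_wpM2r //; have -> : 76 = 68 + 8 :> R by ring.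
  rewrite [leRHS]mulrDl lerD2r ler_pM2l // lef_pV2 ?posrE //.
  exact: stage_mass.
Qed.

Lemma cnt_not_free k m : cnt (predC (Z k)) (m * Q k) <= 16^-1 * (m * Q k)%N%:R.
Proof.
have sub x : predC (Z k) x ->
    predU (fun x => has (fun i => predC (rich i) x) (iota 0 k.+1))
      (old_multiple k) x.
  by rewrite /= negb_and negbK /good -has_predC.
apply: le_trans (cnt_le (fun x _ => sub x)) _.
apply: le_trans (cntU _ _ _) _.
apply: le_trans (lerD (cnt_has _ _ _) (cnt_has _ _ _)) _.
have N0 : 0 <= (m * Q k)%N%:R :> R by [].
(* The shift by 12 in the sizes of the primes is chosen so that the exceptional proportions, summed
   over all levels, stay below 92/2048 < 1/16. *)
apply: (@le_trans _ _ ((16 + 76) * 2048^-1 * (m * Q k)%N%:R)); last first.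
  by rewrite ler_wpM2r //; lra.
rewrite [X in _ <= X * _]mulrDl mulrDl; apply: lerD.
  apply: (@le_trans _ _ (\sum_(i <- iota 0 k.+1)
      16 * (2 ^ (i + 12))%:R^-1 * (m * Q k)%N%:R)).
    rewrite big_seq [leRHS]big_seq; apply: ler_sum => i; rewrite mem_iota => ik.
    exact: cnt_not_rich.
  by rewrite -mulr_suml -mulr_sumr ler_wpM2r // ler_pM2l // geometric_bound.
apply: (@le_trans _ _ (\sum_(i <- iota 0 k)
    76 * (2 ^ (i + 12))%:R^-1 * (m * Q k)%N%:R)).
  rewrite big_seq [leRHS]big_seq; apply: ler_sum => i; rewrite mem_iota => ik.
  exact: cnt_stage_multiple.
by rewrite -mulr_suml -mulr_sumr ler_wpM2r // ler_pM2l // geometric_bound.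
Qed.

Lemma cnt_old_multiple k m :
  cnt (old_multiple k) (m * Q k) <= 16^-1 * (m * Q k)%N%:R.
Proof.
apply: le_trans (cnt_not_free k m); apply: cnt_le => x _ mx /=.
by rewrite negb_and negbK mx orbT.
Qed.

Lemma cnt_free k : 15 / 16 * (Q k)%:R <= cnt (Z k) (Q k).
Proof.
have := cnt_not_free k 1; rewrite mul1n cntC; lra.
Qed.

Lemma ex_free_residue k : exists2 z, (z < Q k)%N & Z k z.
Proof.
apply: contrapT => noZ; have := cnt_free k.
have -> : cnt (Z k) (Q k) = 0.
  rewrite /cnt big_nat big1 // => x /andP[_ xQ].
  by case: (boolP (Z k x)) => // Zx; exfalso; apply: noZ; exists x.
have : 0 < (Q k)%:R :> R by rewrite ltr0n stage_period_gt0.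
by lra.
Qed.

End Construction.

(** * Choice of primes and periods *)

Section Existence.
Context {R : realType}.

(** The three factors may coincide; each divides its own copy of [s!], and the product of the three
    copies divides [(3 * s)!]. *)
Lemma dvdn_fact3 a b c s : (0 < a <= s)%N -> (0 < b <= s)%N ->
  (0 < c <= s)%N -> (a * (b * c) %| (3 * s)`!)%N.
Proof.
move=> aS bS cS.
have factD m n : (m`! * n`! %| (m + n)`!)%N.
  by rewrite -(bin_fact (leq_addr n m)) addKn dvdn_mull.
have -> : (3 * s = s + (s + s))%N by lia.
apply: dvdn_trans (factD _ _); apply: dvdn_mul; first exact: dvdn_fact.
by apply: dvdn_trans (factD _ _); apply: dvdn_mul; exact: dvdn_fact.
Qed.

Lemma ex_recursion (F : nat -> nat -> nat) :
  exists e : nat -> nat, e 0%N = 1%N /\ forall k, e k.+1 = F k (e k).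
Proof. by exists (fun n => nat_rect (fun=> nat) 1%N F n). Qed.

Lemma ex_stages (c : nat -> nat) : (forall k, (0 < c k)%N) ->
  exists S : stages R, forall k, stage_ratio S k = c k.
Proof.
move=> c0.
have [u uP] : {u : nat -> nat & forall i,
    (2 ^ (i + 12))%:R <= prime_mass (primes_in (2 ^ (i + 12)) (u i)) :> R}.
  by apply: (@choice _ _ (fun i v => (2 ^ (i + 12))%:R <=
    prime_mass (primes_in (2 ^ (i + 12)) v) :> R)) => i; exact: prime_mass_diverges.
(* [e k] is the end of stage [k - 1], or 1 if [k = 0], and [u k] bounds the primes of stage [k].
   Then [e k + u k] bounds each factor that has to divide [Q k], the primes of earlier stages
   included. *)
have [e [e0 eS]] := ex_recursion (fun k ek =>
  let q := (3 * (ek + u k))`! in (c k * (2 ^ q * q) + 2 ^ q * q))%N.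
pose Q k := (3 * (e k + u k))`!%N.
have eSQ k : e k.+1 = (c k * (2 ^ Q k * Q k) + 2 ^ Q k * Q k)%N by exact: eS.
have fact_ge n : (n <= n`!)%N.
  by case: n => // n; rewrite dvdn_leq ?fact_gt0 // dvdn_fact //= leqnn.
have Qge k : (3 * (e k + u k) <= Q k)%N by exact: fact_ge.
have Q0 k : (0 < Q k)%N by exact: fact_gt0.
have QE k : (Q k <= e k.+1)%N.
  rewrite eSQ; apply: leq_trans (leq_addl _ _).
  by rewrite leq_pmull // expn_gt0.
have ek k : (k < e k)%N.
  by elim: k => [|k IHk]; [rewrite e0|have := QE k; have := Qge k; lia].
have emono i k : (i <= k)%N -> (e i <= e k)%N.
  elim: k => [|k IHk]; first by rewrite leqn0 => /eqP ->.
  rewrite leq_eqVlt => /orP[/eqP -> //|/IHk].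
  by have := QE k; have := Qge k; lia.
have pb i k p : (i <= k)%N -> p \in primes_in (2 ^ (i + 12)) (u i) ->
    (0 < p <= e k + u k)%N.
  move=> ik; rewrite mem_primes_in => /and3P[/prime_gt0 -> _ pu] /=.
  move: ik; rewrite leq_eqVlt => /orP[/eqP <-|/emono]; first by lia.
  by have := QE i; have := Qge i; lia.
have small k : (0 < 1 <= e k + u k)%N by have := ek k; lia.
unshelve eexists (@Stages R (fun i => primes_in (2 ^ (i + 12)) (u i)) Q c
  _ _ _ _ _ _ _ _ _ _) => //=.
- by move=> i p; rewrite mem_primes_in => /and3P[].
- by move=> i; exact: primes_in_uniq.
- by move=> i p; rewrite mem_primes_in => /and3P[_ /ltnW].
- move=> i k p q ik pP qP; rewrite -(mul1n (p * q)%N).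
  by apply: dvdn_fact3; rewrite ?small ?(pb _ _ _ ik).
- move=> i k a p q ik /andP[a0]; rewrite -eSQ => ae pP qP.
  have {}a0 : (0 < a <= e k + u k)%N by have := emono _ _ ik; lia.
  by apply: dvdn_fact3; rewrite ?a0 ?(pb _ _ _ (ltnW ik)).
- move=> n k /andP[n0 nk]; apply: dvdn_fact; rewrite n0 /=.
  by have := ek k; lia.
- by move=> k; rewrite -eSQ; have := Qge k.+1; lia.
Qed.

End Existence.

(** * The Toeplitz property, irregularity and oscillating densities *)

Section Structure.
Context {R : realType}.
Variable S : stages R.
Notation P := (stage_primes S).
Notation Q := (stage_period S).
Notation T := (stage_start S).
Notation E := (stage_end S).
Notation A := (stage_set S).
Notation B := (stage_union S).
Notation Z := (free_residue S).
Notation cnt := (@cnt R).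

Lemma stage_union_gt1 : B `<=` [set b | (1 < b)%N].
Proof.
move=> b [k]; rewrite mem_stage_set => /and3P[/andP[Tb _] _ _].
exact: leq_trans (stage_start_gt1 S k) Tb.
Qed.

Lemma stage_elem_gt0 k b : b \in A k -> (0 < b)%N.
Proof. by move=> bA; apply: ltnW; apply: stage_union_gt1; exists k. Qed.

(** Block [2 ^ z] has digit 1 at position [z]. This makes the set nonempty and shows that both
    digits occur at each free residue, since block 0 has digit 0. *)
Lemma mem_stage_start k z : (z < Q k)%N -> Z k z ->
  (T k + (2 ^ z * Q k + z))%N \in A k.
Proof.
move=> zQ Zz; have z2 : (2 ^ z < 2 ^ Q k)%N by rewrite ltn_exp2l.
have := eta_window z2 zQ Zz.
rewrite eta_multiples bit_exp2 => /negbFE.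
rewrite (@multiple_within _ _ k) ?leq_addr ?window_lt // => /orP[|//].
have TQ : (T k + (2 ^ z * Q k + z) = (stage_ratio S k * 2 ^ Q k + 2 ^ z) * Q k + z)%N.
  by rewrite mulnDl -mulnA addnA.
have /andP[_ /negPf-> //] : Z k (T k + (2 ^ z * Q k + z))%N.
by rewrite TQ -free_residue_mod modnMDl free_residue_mod.
Qed.

Lemma stage_toeplitz : toeplitz (eta B).
Proof.
move=> n; case: (boolP (n \in multiples B)) => [nM|nF].
  have /mem_multiples[k /hasP[b bA bn]] := nM.
  have b0 := stage_elem_gt0 bA.
  exists b => // m; rewrite !eta_multiples nM; congr negb; apply/esym.
  apply/mem_multiples; exists k; apply/hasP; exists b => //.
  have : (b%:Z %| n + m * b%:Z)%Z by rewrite rpredDr ?dvdz_mull //; rewrite dvdzE.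
  by rewrite dvdzE.
pose K := `|n|%N.
pose p := ((\prod_(q <- P K) q) *
           \prod_(i <- iota 0 K) \prod_(b <- A i) b)%N.
have p0 : (0 < p)%N.
  rewrite muln_gt0 !big_seq; apply/andP; split; apply/prodn_cond_gt0.
    by move=> q /stage_prime/prime_gt0.
  by move=> i _; rewrite big_seq; apply/prodn_cond_gt0 => b /stage_elem_gt0.
(* The integer 0 is a multiple of any element, and stage 0 has one, so a free [n] is nonzero. *)
have n0 : (0 < K)%N.
  rewrite absz_gt0; apply: contraNneq nF => ->; apply/mem_multiples.
  have [z zQ Zz] := ex_free_residue S 0.
  exists 0%N; apply/hasP; exists (T 0 + (2 ^ z * Q 0 + z))%N => //.
  exact: mem_stage_start.
exists p => // m; rewrite !eta_multiples nF; apply/esym.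
apply: contra nF => /mem_multiples[k /hasP[b bA]].
rewrite -[b]/`|b%:Z|%N -dvdzE => bn.
have [kK|Kk] := ltnP k K.
  have bp : (b %| p)%N.
    apply: dvdn_mull; rewrite (big_rem k) ?mem_iota //=.
    by apply: dvdn_mulr; rewrite (big_rem b) //= dvdn_mulr.
  apply/mem_multiples; exists k; apply/hasP; exists b => //.
  rewrite -[b]/`|b%:Z|%N -dvdzE -(@rpredDr _ _ (m * p%:Z)) //.
  by rewrite dvdz_mull // dvdzE.
(* Now [K <= k], so [b] is rich at level [K] and has a divisor [q] in [P K]. It divides [p], hence
   [n], contradicting [q >= 2 ^ (K + 12) > |n| > 0]. *)
move: bA; rewrite mem_stage_set => /and3P[_ /allP gb _].
have : rich S K b by apply: gb; rewrite mem_iota.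
have [[q qP qb] _|noq] := pselect (exists2 q, q \in P K & (q %| b)%N).
  exfalso; have qp : (q %| p)%N by apply: dvdn_mulr; rewrite (big_rem q) //= dvdn_mulr.
  have : (q%:Z %| n)%Z.
    rewrite -(@rpredDr _ _ (m * p%:Z)); last by rewrite dvdz_mull // dvdzE.
    by apply: dvdz_trans bn; rewrite dvdzE.
  rewrite dvdzE => /(dvdn_leq n0); have := stage_large qP.
  have := ltn_expl (K + 12) (isT : 1 < 2)%N; rewrite /K /=; lia.
rewrite /rich /omega big_seq big1 => [|q qP].
  by have := stage_mass_gt0 S K; lra.
by case: (boolP (q %| b)%N) => // qb; case: noq; exists q.
Qed.

(** Stage [p] itself is used: [p] divides [Q p], so [eta] would be constant on the positions of
    residue [n %% Q p] in its window. At a free residue the blocks 0 and [2 ^ z] give different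
    values. *)
Lemma per_not_free p (n : nat) : (0 < p)%N -> n%:Z \in per p (eta B) ->
  ~~ Z p n.
Proof.
move=> p0; rewrite in_setE /per /= => pern; apply/negP => Zn.
have zQ : (n %% Q p < Q p)%N by rewrite ltn_mod stage_period_gt0.
have Zz : Z p (n %% Q p)%N by rewrite free_residue_mod.
have [d Qd] : exists d, Q p = (d * p)%N.
  by apply/dvdnP; apply: stage_nat_dvd; rewrite p0 /=.
have same j : eta B (T p + (j * Q p + n %% Q p))%N%:Z = eta B n%:Z.
  rewrite [RHS](pern ((stage_ratio S p * 2 ^ Q p + j)%N%:Z * d%:Z -
    (n %/ Q p)%N%:Z * d%:Z)); congr (eta B _).
  rewrite {2}(divn_eq n (Q p)) /stage_start !(PoszD, PoszM) Qd PoszM; ring.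
have := eta_window (expn_gt0 _ _ : 0 < 2 ^ Q p)%N zQ Zz.
have z2 : (2 ^ (n %% Q p) < 2 ^ Q p)%N by rewrite ltn_exp2l.
have := eta_window z2 zQ Zz.
by rewrite !same => ->; rewrite bit_exp2 bit0n.
Qed.

Lemma stage_irregular : irregular_toeplitz R (eta B).
Proof.
split; first exact: stage_toeplitz.
rewrite /regular_toeplitz => sup1.
suff : sup [set density R (per p (eta B)) | p in [set p | (0 < p)%N]] <= 8^-1.
  by rewrite sup1; lra.
apply: ge_sup; first by exists (density R (per 1 (eta B))); exists 1%N.
move=> _ [p /= p0 <-]; apply: lower_density_le => n0.
(* At a multiple of [Q p] the bound 1/16 of [cnt_not_free] applies. Frequencies include the end
   point [N], whose share is at most another 1/16 because [N >= 16]. *)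
exists ((n0 + 16) * Q p)%N.
  by rewrite -[leqLHS]muln1 leq_mul ?leq_addr ?stage_period_gt0.
set N := ((n0 + 16) * Q p)%N.
have N16 : (16 <= N)%N.
  by rewrite -[leqLHS]muln1 leq_mul ?leq_addl ?stage_period_gt0.
apply: le_trans (freq_le_cnt (D := predC (Z p)) _) _.
  by move=> n _; exact: per_not_free.
rewrite mulrC ler_pdivrMr ?ltr0n; last by lia.
rewrite -addn1 cntD; have := cnt_not_free S p (n0 + 16); rewrite -/N.
have : cnt (fun x => predC (Z p) (N + x)%N) 1 <= 1 by exact: cnt_leN.
have : 16 <= N%:R :> R by rewrite ler_nat.
by move: (cnt _ _) (cnt _ _) => x y; lra.
Qed.

Lemma stage_index_le_period k : (k <= Q k)%N.
Proof.
by case: k => // k; rewrite dvdn_leq ?stage_period_gt0 // stage_nat_dvd ?leqnn.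
Qed.

Lemma stage_index_lt_width k : (k < 2 ^ Q k * Q k)%N.
Proof.
apply: leq_ltn_trans (stage_index_le_period k) _.
have := stage_period_gt0 S k; have := ltn_expl (Q k) (isT : 1 < 2)%N.
by move: (2 ^ Q k)%N => t; nia.
Qed.

Lemma stage_index_lt k : (k < T k)%N.
Proof. exact: leq_trans (stage_index_lt_width k) (stage_width_le S k). Qed.

(** At each free residue exactly half of the blocks have digit 1, whence 15/16 * 1/2. *)
Lemma cnt_window k :
  15 / 32 * (2 ^ Q k * Q k)%N%:R <=
  cnt (fun x => (T k + x)%N%:Z \in multiples B) (2 ^ Q k * Q k).
Proof.
rewrite cnt_blocks.
apply: (@le_trans _ _ (\sum_(0 <= j < 2 ^ Q k) \sum_(0 <= z < Q k)
    (Z k z && bit j z)%:R)); last first.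
  apply: ler_sum_nat => j /andP[_ jQ]; apply: ler_sum_nat => z /andP[_ zQ].
  rewrite ler_nat; case: (boolP (Z k z)) => //= Zz.
  have := eta_window jQ zQ Zz; rewrite eta_multiples => /(congr1 negb).
  by rewrite !negbK => ->.
rewrite exchange_big /=.
have -> : \sum_(0 <= z < Q k) \sum_(0 <= j < 2 ^ Q k) (Z k z && bit j z)%:R =
    \sum_(0 <= z < Q k) (Z k z)%:R * (2 ^+ Q k / 2) :> R.
  apply: eq_big_nat => z /andP[_ zQ].
  rewrite -(cnt_bit zQ) mulr_sumr; apply: eq_bigr => j _.
  by rewrite -natrM mulnb.
rewrite -mulr_suml natrM natrX; have := cnt_free S k; rewrite /cnt => H.
have : 0 < 2 ^+ Q k :> R by rewrite exprn_gt0.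
move: H; move: (\sum_(_ <= _ < _) _) (2 ^+ Q k) (Q k)%:R => s t q; nra.
Qed.

Lemma stage_not_besicovitch : (forall k, stage_ratio S k = 1%N) ->
  ~ besicovitch R B.
Proof.
move=> c1; rewrite /besicovitch /has_density => dens.
(* Before [T k] there are only old multiples, at most [T k / 16] of them; 1/8 leaves room for
   dividing by [T k - 1]. *)
have lo : lower_density R (multiples B) <= 8^-1.
  apply: lower_density_le => k; exists (T k).-1.
    by have := stage_index_lt k; lia.
  have T2 := stage_start_gt1 S k.
  apply: le_trans (freq_le_cnt (D := old_multiple S k) _) _.
    by move=> n nT nM; rewrite -multiple_before //; lia.
  rewrite mulrC ler_pdivrMr ?ltr0n; last by lia.
  rewrite prednK; last by lia.
  have := cnt_old_multiple S k (stage_ratio S k * 2 ^ Q k).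
  rewrite -mulnA -/(T k) => /le_trans; apply.
  have -> : (T k)%:R = (T k).-1%:R + 1 :> R by rewrite natr1 prednK //; lia.
  have : 1 <= (T k).-1%:R :> R by rewrite ler1n; lia.
  by lra.
(* With ratio 1 the window is half of [0, E k), which halves 15/32. *)
have hi : 15 / 64 <= upper_density R (multiples B).
  apply: upper_density_ge => k; exists (E k).-1.
    by have := stage_index_lt k; have := stage_start_lt_end S k; lia.
  have TW : (T k = 2 ^ Q k * Q k)%N by rewrite /stage_start c1 mul1n.
  have T2 := stage_start_gt1 S k; have TE := stage_start_lt_end S k.
  rewrite freqE [leRHS]mulrC ler_pdivlMr ?ltr0n; last by lia.
  rewrite prednK; last by lia.
  rewrite /stage_end cntD.
  apply: le_trans (_ : 15 / 32 * (2 ^ Q k * Q k)%N%:R <= _); last first.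
    apply: le_trans (cnt_window k) _; rewrite -[leLHS]add0r.
    apply: lerD (cnt_ge0 _ _) _; apply: cnt_le => x _ ->.
    by rewrite andbT; lia.
  rewrite -TW; apply: (@le_trans _ _ (15 / 64 * (2 * (T k)%:R))); last by lra.
  by rewrite ler_pM2l // -natrM ler_nat; lia.
by move: lo hi; rewrite dens; lra.
Qed.

End Structure.

(** * Cylinders and measures on the space of bi-infinite sequences *)

Section Cylinders.

(* The coordinates of a bi-infinite sequence, listed as 0, -1, 1, -2, 2, ... *)
Definition zcode (z : int) : nat :=
  match z with Posz n => n.*2 | Negz n => n.*2.+1 end.

Definition zidx (n : nat) : int := if odd n then Negz n./2 else Posz n./2.

Lemma zcodeK : cancel zcode zidx.
Proof.
by case=> n; rewrite /zidx /= odd_double /= ?doubleK // uphalf_double.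
Qed.

Lemma zidxK : cancel zidx zcode.
Proof.
move=> n; rewrite -[RHS](odd_double_half n) /zidx.
by case: (odd n).
Qed.

Definition agree (n : nat) (x y : biseq) : Prop :=
  forall i, (i < n)%N -> x (zidx i) = y (zidx i).

Definition prefix_of (n : nat) (x : biseq) : seq bool :=
  mkseq (fun i => x (zidx i)) n.

Definition extend (s : seq bool) : biseq := fun z => nth false s (zcode z).

Definition cyl (s : seq bool) : set biseq :=
  [set x | prefix_of (size s) x = s].

Lemma size_prefix_of n x : size (prefix_of n x) = n.
Proof. exact: size_mkseq. Qed.

Lemma prefix_ofP n x y : prefix_of n x = prefix_of n y <-> agree n x y.
Proof.
split=> [xy i iN|xy].
  by have := congr1 (fun s => nth false s i) xy; rewrite !nth_mkseq.
by apply/eq_in_map => i; rewrite mem_iota => /andP[_ /xy].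
Qed.

Lemma prefix_of_extend s : prefix_of (size s) (extend s) = s.
Proof.
apply: (@eq_from_nth _ false); rewrite size_prefix_of // => i iN.
by rewrite nth_mkseq // /extend zidxK.
Qed.

Lemma agree_extend n x : agree n x (extend (prefix_of n x)).
Proof.
apply/prefix_ofP.
by have := prefix_of_extend (prefix_of n x); rewrite size_prefix_of.
Qed.

Lemma cyl_prefix n x : cyl (prefix_of n x) = agree n x.
Proof.
apply/seteqP; split=> y; rewrite /cyl /= size_prefix_of prefix_ofP => xy i iN;
  by rewrite xy.
Qed.

Lemma prefix_of_rcons n x :
  prefix_of n.+1 x = rcons (prefix_of n x) (x (zidx n)).
Proof. by rewrite /prefix_of mkseqS. Qed.

(** The product topology is a supremum of initial topologies, so convergence to [x] of the filter
    generated by the sets [agree n x] can be tested on one coordinate at a time. *)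
Lemma nbhs_biseqP (x : biseq) (O : set biseq) :
  nbhs x O -> exists n, agree n x `<=` O.
Proof.
move=> xO.
pose F : set_system biseq := [set O | exists n, agree n x `<=` O].
have FF : Filter F.
  split; first by exists 0%N.
  - move=> U V [m mU] [n nV]; exists (maxn m n) => y xy; split.
      by apply: mU => i im; apply: xy; rewrite leq_max im.
    by apply: nV => i im; apply: xy; rewrite leq_max im orbT.
  - by move=> U V UV [m mU]; exists m; exact: subset_trans UV.
suff Fx : F --> (x : prod_topology (fun _ : int => bool)) by exact: Fx.
apply/cvg_sup => i U; rewrite nbhsE /= => -[_ [[V Vop <-] Vx] sVU].
exists (zcode i).+1 => y xy; apply: sVU; rewrite /preimage /= /proj.
by have := xy (zcode i) (leqnn _); rewrite zcodeK => <-.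
Qed.

Lemma proj_biseq_continuous (i : int) : continuous (fun x : biseq => x i).
Proof.
exact: (@proj_continuous int (fun=> bool) i).
Qed.

Lemma open_coordinate (i : int) (b : bool) : open [set x : biseq | x i = b].
Proof.
have /continuousP/(_ [set b] (discrete_open _)) := @proj_biseq_continuous i.
exact.
Qed.

Lemma open_cyl s : open (cyl s).
Proof.
rewrite -(prefix_of_extend s) cyl_prefix; set x := extend s.
elim: (size s) => [|n IHn].
  by rewrite (_ : agree 0 x = setT); [exact: openT|apply/seteqP].
rewrite (_ : agree n.+1 x = agree n x `&` [set y | y (zidx n) = x (zidx n)]).
  by apply: openI => //; exact: open_coordinate.
apply/seteqP; split=> y /=.
  by move=> xy; split=> [i iN|]; [apply: xy; exact: ltnW|rewrite xy].
move=> [xy xn] i; rewrite ltnS leq_eqVlt => /orP[/eqP->|/xy] //.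
Qed.

Lemma open_biseqE (O : set biseq) : open O ->
  O = \bigcup_(s in [set s | cyl s `<=` O]) cyl s.
Proof.
move=> oO; apply/seteqP; split=> x; last by case=> s /= sO /sO.
move=> Ox; have [n nO] : exists n, agree n x `<=` O.
  by apply: nbhs_biseqP; apply: open_nbhs_nbhs.
by exists (prefix_of n x); rewrite /= cyl_prefix.
Qed.

Lemma measurable_cyl s : measurable (cyl s).
Proof. by apply: sub_sigma_algebra; exact: open_cyl. Qed.

Lemma compact_biseq : compact [set: biseq].
Proof.
have := @tychonoff int (fun=> bool) (fun=> setT) (fun=> bool_compact).
by congr (compact _); apply/seteqP.
Qed.

(** Compactness: finitely many sets [agree (n x) x], on each of which [f] varies little, cover the
    space, and the largest [n x] works everywhere. *)
Lemma continuous_biseq_uniform (R : realType) (f : biseq -> R) (e : R) :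
  continuous f -> 0 < e ->
  exists n, forall x y, agree n x y -> `|f x - f y| < e.
Proof.
move=> cf e0; have e20 : 0 < e / 2 by rewrite divr_gt0.
have loc x : exists n, forall y, agree n x y -> `|f x - f y| < e / 2.
  have := cf x; move/cvgrPdist_lt => /(_ _ e20) /nbhs_biseqP[n nU].
  by exists n => y /nU.
have [n nP] := choice loc.
have := compact_biseq; rewrite compact_cover.
move=> /(_ biseq setT (fun x => agree (n x) x)).
case=> [x _|x _|D _ covD].
- by rewrite -cyl_prefix; exact: open_cyl.
- by exists x.
exists (\max_(x <- finmap.enum_fset D) n x)%N => y z yz.
have [x xD xy] := covD y I.
have le_nx : (n x <= \max_(x <- finmap.enum_fset D) n x)%N.
  by apply: (@leq_bigmax_seq _ _ _ (fun x => n x)).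
rewrite (_ : f y - f z = (f x - f z) - (f x - f y)); last by ring.
apply: le_lt_trans (ler_normB _ _) _; rewrite [e](splitr e) ltrD ?nP //.
by move=> i iN; rewrite xy // yz // (leq_trans iN).
Qed.

End Cylinders.

(** Turns a union over words into one over [nat], as closure properties of sigma-algebras and null
    sets are stated for the latter. *)
Lemma bigcup_countE (I : countType) (T : Type) (D : set I) (F : I -> set T) :
  \bigcup_(s in D) F s =
  \bigcup_n (if unpickle n is Some s then if `[<D s>] then F s else set0
             else set0).
Proof.
apply/seteqP; split=> x.
  by move=> [s Ds Fx]; exists (pickle s) => //=; rewrite pickleK asboolT.
by move=> [n _]; case: (unpickle n) => // s; case: asboolP => // Ds Fx; exists s.
Qed.

Lemma sigma_algebra_bigcup_count (I : countType) (T : Type)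
    (G : set (set T)) (D : set I) (F : I -> set T) :
  (forall s, D s -> <<s G >> (F s)) -> <<s G >> (\bigcup_(s in D) F s).
Proof.
move=> GF; rewrite bigcup_countE; apply: sigma_algebra_bigcup => n.
case: (unpickle n) => [s|]; last exact: sigma_algebra0.
by case: asboolP => [/GF //|_]; exact: sigma_algebra0.
Qed.

Lemma measure_bigcup_finType d (T : measurableType d) (R : realType)
    (mu : {measure set T -> \bar R}) (I : finType) (F : I -> set T) :
  (forall i, measurable (F i)) -> trivIset setT F ->
  mu (\bigcup_i F i) = (\sum_i mu (F i))%E.
Proof.
move=> mF tF; rewrite measure_fin_bigcup //; last exact: finite_finset.
rewrite fsbig_finite; last exact: finite_finset.
rewrite (perm_big (enum I)) /=; last first.
  apply: uniq_perm; rewrite ?finmap.fset_uniq ?enum_uniq //.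
  move=> i; rewrite mem_enum in_fset_set; last exact: finite_finset.
  by transitivity true => //; exact: mem_set.
by rewrite big_enum; apply: eq_big.
Qed.

(** * Cylinders generate the Borel sigma-algebra and determine measures *)

Section BorelCylinders.

Definition cyls : set (set biseq) := [set X | X = set0 \/ exists s, X = cyl s].

(** Two cylinders are nested or disjoint; the empty set is in [cyls] for the second case. *)
Lemma cyls_setI : setI_closed cyls.
Proof.
have sub s t x : (size s <= size t)%N -> cyl s x -> cyl t x -> cyl t `<=` cyl s.
  move=> st sx tx y ty; rewrite /cyl /= -[RHS]sx; apply/prefix_ofP => i iS.
  have /prefix_ofP -> // : prefix_of (size t) y = prefix_of (size t) x.
    by rewrite ty tx.
  exact: leq_trans iS st.
have main s t : (size s <= size t)%N -> cyls (cyl s `&` cyl t).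
  move=> st; have [->|/set0P[x [sx tx]]] := eqVneq (cyl s `&` cyl t) set0.
    by left.
  by right; exists t; apply/setIidr; exact: sub tx.
move=> _ _ [->|[s ->]] [->|[t ->]]; rewrite ?set0I ?setI0; try by left.
by case/orP: (leq_total (size s) (size t)) => st; [|rewrite setIC]; exact: main.
Qed.

Lemma measurable_cyls : cyls `<=` @measurable _ biseq.
Proof. by move=> _ [->|[s ->]]; [exact: measurable0|exact: measurable_cyl]. Qed.

Lemma measurable_biseqE : @measurable _ biseq = <<s cyls >>.
Proof.
apply/seteqP; split; last first.
  by apply: smallest_sub; [exact: sigma_algebra_measurable|exact: measurable_cyls].
apply: smallest_sub; first exact: smallest_sigma_algebra.
move=> O oO; rewrite (open_biseqE oO).
apply: sigma_algebra_bigcup_count => s _.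
by apply: sub_sigma_algebra; right; exists s.
Qed.

Lemma measure_cyl_unique (R : realType) (m1 m2 : {measure set biseq -> \bar R}) :
  (m1 setT < +oo)%E -> (forall s, m1 (cyl s) = m2 (cyl s)) ->
  forall X, measurable X -> m1 X = m2 X.
Proof.
move=> fin1 m12 X mX.
have cT : cyl [::] = setT by apply/seteqP.
apply: (g_sigma_algebra_measure_unique_trace cyls setT) => //.
- by move=> Y [/measurable_cyls].
- move=> Y1 Y2 [c1 _] [c2 _]; split; last by [].
  exact: cyls_setI.
- by rewrite -cT.
- by move=> Y [[->|[s ->]] _]; [rewrite !measure0|exact: m12].
- have -> : [set Y | cyls Y /\ Y `<=` setT] = cyls.
    by apply/seteqP; split=> [Y []|Y cY] //; split.
  by rewrite -measurable_biseqE.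
Qed.

Lemma measurable_fun_biseq d (T : measurableType d) (f : T -> biseq) :
  (forall s, measurable (f @^-1` cyl s)) -> measurable_fun setT f.
Proof.
move=> mf; apply: (measurability cyls measurable_biseqE) => _ [_ [->|[s ->]] <-].
  by rewrite preimage_set0 setI0; exact: measurable0.
by rewrite setTI.
Qed.

End BorelCylinders.

(** * Kolmogorov extension from weights of cylinders *)

Section MeasureFromCylinders.
Context {R : realType}.
Variable m : seq bool -> R.
Hypothesis m_ge0 : forall s, 0 <= m s.
Hypothesis m_nil : m [::] = 1.
Hypothesis m_rcons : forall s, m s = m (rcons s false) + m (rcons s true).

(* [0, 1) is cut into intervals indexed by words, the interval of s having
   length m s and left end point [left_end s]; a point u of [0, 1) is mapped
   to the sequence of which all the prefixes index intervals containing u. *)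
Fixpoint rev_left_end (r : seq bool) : R :=
  if r is b :: r' then
    rev_left_end r' + (if b then m (rcons (rev r') false) else 0)
  else 0.

Definition left_end (s : seq bool) : R := rev_left_end (rev s).

Lemma left_end_rcons s b : left_end (rcons s b) =
  left_end s + (if b then m (rcons s false) else 0).
Proof. by rewrite /left_end rev_rcons /= revK. Qed.

Definition next_bit (u : R) (s : seq bool) : bool :=
  left_end s + m (rcons s false) <= u.

Definition word_of (u : R) (n : nat) : seq bool :=
  iter n (fun s => rcons s (next_bit u s)) [::].

Definition point_of (u : R) : biseq :=
  fun z => next_bit u (word_of u (zcode z)).

Lemma prefix_point_of u n : prefix_of n (point_of u) = word_of u n.
Proof.
elim: n => // n IHn; rewrite prefix_of_rcons IHn /point_of zidxK //.
Qed.

(** The interval of [s] is split at [left_end s + m (rcons s false)], and [next_bit] tells on which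
    side of this point [u] lies. *)
Lemma word_ofP (u : R) s : 0 <= u < 1 ->
  (word_of u (size s) == s) = (left_end s <= u < left_end s + m s).
Proof.
move=> u01; elim/last_ind: s => [|s b IHs].
  by rewrite /left_end /= m_nil add0r u01.
rewrite size_rcons /= eqseq_rcons left_end_rcons.
have := m_ge0 (rcons s false); have := m_ge0 (rcons s true).
move: IHs; rewrite (m_rcons s).
case: (eqVneq (word_of u (size s)) s) => [->|_] /esym/andP IHs h1 h0 /=.
  case: IHs => l1 l2; rewrite /next_bit.
  case: b => /=.
    rewrite eqb_id; apply/idP/andP => [h|[] //]; split=> //; lra.
  rewrite eqbF_neg -ltNge addr0.
  by apply/idP/andP => [h|[] //]; split.
apply/esym/negbTE/negP => /andP[l1 l2]; apply: IHs.
by case: b l1 l2 => /=; lra.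
Qed.

Lemma measurable_word_of n s : measurable [set u | word_of u n = s].
Proof.
elim: n s => [|n IHn] s.
  have [->|s0] := eqVneq s [::].
    by rewrite (_ : [set _ | _] = setT) //; apply/seteqP.
  rewrite (_ : [set _ | _] = set0) //; apply/seteqP; split=> // u /= us.
  by rewrite -us eqxx in s0.
case/lastP: s => [|s b].
  rewrite (_ : [set _ | _] = set0) //; apply/seteqP; split=> // u /= /eqP.
  by rewrite -size_eq0 size_rcons.
have mitv : measurable [set u : R | next_bit u s = b].
  rewrite /next_bit; set c := left_end s + _.
  case: b.
    rewrite (_ : [set _ | _] = `[c, +oo[%classic) //.
    by apply/seteqP; split=> u /=; rewrite in_itv /= andbT.
  rewrite (_ : [set _ | _] = `]-oo, c[%classic) //.
  apply/seteqP; split=> u /=; rewrite in_itv /= ltNge.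
    by move=> ->.
  by move/negbTE.
rewrite (_ : [set _ | _] = [set u | word_of u n = s] `&`
    [set u | next_bit u s = b]); first by apply: measurableI.
apply/seteqP; split=> u /=.
  by move=> /eqP; rewrite eqseq_rcons => /andP[/eqP-> /eqP].
by move=> [-> ->].
Qed.

Lemma measurable_point_of : measurable_fun [set: R] point_of.
Proof.
apply: measurable_fun_biseq => s; rewrite (_ : _ @^-1` _ =
  [set u | word_of u (size s) = s]); first exact: measurable_word_of.
by apply/seteqP; split=> u /=; rewrite /cyl /= prefix_point_of.
Qed.

Lemma measurable_unit_itv : measurable (`[0, 1[ : set R).
Proof. exact: measurable_itv. Qed.

Definition unit_measure : set (measurableTypeR R) -> \bar R :=
  mrestr lebesgue_measure measurable_unit_itv.

HB.instance Definition _ := Measure.on unit_measure.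

Lemma unit_measureT : unit_measure setT = 1%E.
Proof.
rewrite /unit_measure /mrestr setTI lebesgue_measure_itv /= lte_fin ltr01.
by rewrite sube0.
Qed.

HB.instance Definition _ := Measure_isProbability.Build _ _ R unit_measure
  unit_measureT.

Definition point_rv : measurableTypeR R -> biseq := point_of.

HB.instance Definition _ := isMeasurableFun.Build _ _ (measurableTypeR R) biseq
  point_rv measurable_point_of.

Definition cyl_prob : probability biseq R := distribution unit_measure point_rv.

Lemma left_end_bounds s : 0 <= left_end s /\ left_end s + m s <= 1.
Proof.
elim/last_ind: s => [|s b [IH1 IH2]].
  by rewrite /left_end /= m_nil add0r.
rewrite left_end_rcons.
have := m_ge0 (rcons s false); have := m_ge0 (rcons s true).
by move: IH2; rewrite (m_rcons s); case: b => /= ? ? ?; split; lra.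
Qed.

(** The points of [0, 1) sent into [cyl s] form the interval of [s], whose Lebesgue measure is
    [m s]. *)
Lemma cyl_probE s : cyl_prob (cyl s) = (m s)%:E.
Proof.
rewrite /cyl_prob /distribution /pushforward /= /unit_measure /mrestr.
have [l0 l1] := left_end_bounds s.
rewrite (_ : _ `&` _ = `[left_end s, left_end s + m s[%classic).
  rewrite lebesgue_measure_itv /= lte_fin.
  case: ltP => [_|ms]; first by rewrite -EFinB addrAC subrr add0r.
  by congr EFin; have := m_ge0 s; lra.
apply/seteqP; split=> u /=; rewrite /cyl /= prefix_point_of !in_itv /=.
  by move=> [us u01]; rewrite -word_ofP // us.
move=> us; have u01 : 0 <= u < 1 by lra.
by split=> //; apply/eqP; rewrite word_ofP.
Qed.

End MeasureFromCylinders.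

Lemma ex_cyl_prob (R : realType) (m : seq bool -> R) :
  (forall s, 0 <= m s) -> m [::] = 1 ->
  (forall s, m s = m (rcons s false) + m (rcons s true)) ->
  exists mu : probability biseq R, forall s, mu (cyl s) = (m s)%:E.
Proof.
by move=> m0 m1 ms; exists (cyl_prob m) => s; exact: cyl_probE.
Qed.

Definition prefix_tuple n (x : biseq) : n.-tuple bool :=
  Tuple (introT eqP (size_prefix_of n x)).

Lemma cvg_sumR (R : realType) (I : finType) (f : nat -> I -> R) (l : I -> R) :
  (forall i, f n i @[n --> \oo] --> l i) ->
  \sum_i f n i @[n --> \oo] --> \sum_i l i.
Proof.
by move=> fl; apply: (@cvg_big _ _ +%R 0 xpredT add_continuous) => // i _.
Qed.

(** * Weak convergence from convergence on cylinders *)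

Section WeakConvergence.
Context {R : realType}.

Lemma continuous_biseq_measurable (f : biseq -> R) :
  continuous f -> measurable_fun setT f.
Proof.
move=> cf; apply: (measurability _ (RGenOInfty.measurableE R)) => _ [_ [x ->] <-].
rewrite setTI; apply: sub_sigma_algebra.
by apply: open_comp => //; exact: interval_open.
Qed.

Lemma continuous_biseq_bounded (f : biseq -> R) :
  continuous f -> exists M, forall x, `|f x| <= M.
Proof.
move=> cf; have [n nP] := continuous_biseq_uniform cf (@ltr01 R).
exists (1 + \sum_(w : n.-tuple bool) `|f (extend w)|) => x.
have := nP _ _ (@agree_extend n x); set y := extend _ => fxy.
rewrite -(subrK (f y) (f x)); apply: le_trans (ler_normD _ _) _.
apply: lerD; first exact: ltW.
by rewrite (bigD1 (prefix_tuple n x)) //= lerDl sumr_ge0.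
Qed.

Variable nu : {measure set biseq -> \bar R}.
Hypothesis nu_le1 : (nu setT <= 1)%E.

Lemma submeasure_cyl_fin s : nu (cyl s) \is a fin_num.
Proof.
rewrite ge0_fin_numE // (le_lt_trans (_ : _ <= 1)%E) ?ltry //.
apply: le_trans nu_le1; apply: le_measure => //; rewrite ?inE //.
exact: measurable_cyl.
Qed.

(** [f] is replaced by a function constant on the cylinders of length [n], at distance less than
    [e]. The mass of [nu] is only bounded by 1 because the empirical measure for [N = 0] is zero. *)
Lemma integral_cyl_sum (f : biseq -> R) (n : nat) (e : R) :
  continuous f -> (forall x y, agree n x y -> `|f x - f y| < e) ->
  (\int[nu]_x (f x)%:E)%E \is a fin_num /\
  `|fine (\int[nu]_x (f x)%:E)%E -
    \sum_(w : n.-tuple bool) f (extend w) * fine (nu (cyl w))| <= e.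
Proof.
move=> cf fe; have e0 : 0 <= e.
  by have := fe point point (fun _ _ => erefl); rewrite subrr normr0 => /ltW.
have nuoo : (nu setT < +oo)%E by rewrite (le_lt_trans nu_le1) ?ltry.
have mf := continuous_biseq_measurable cf.
have [M fM] := continuous_biseq_bounded cf.
have intf : nu.-integrable setT (EFin \o f).
  apply: measurable_bounded_integrable => //.
  exists M; split; first exact: num_real.
  by move=> x Mx y _ /=; exact: le_trans (fM y) (ltW Mx).
pose g x := f (extend (prefix_of n x)).
pose h (w : n.-tuple bool) x : R := f (extend w) * \1_(cyl w) x.
have gE x : g x = \sum_(w : n.-tuple bool) h w x.
  pose v := prefix_tuple n x.
  rewrite (bigD1 v) //= big1 ?addr0.
    rewrite /h indicE mem_set ?mulr1 //.
    by rewrite /cyl /= size_prefix_of.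
  move=> w wv; rewrite /h indicE memNset ?mulr0 //; rewrite /cyl /= size_tuple.
  by move=> xw; case/eqP: wv; apply: val_inj; rewrite /= -xw.
have mh w : measurable_fun setT (h w).
  apply: measurable_funM; first exact: measurable_cst.
  by apply: measurable_indic; exact: measurable_cyl.
have inth w : nu.-integrable setT (fun x => (h w x)%:E).
  apply: (@measurable_bounded_integrable _ _ _ nu (h w)) => //.
  exists `|f (extend w)|; split; first exact: num_real.
  move=> x Mx y _ /=; apply: le_trans (ltW Mx).
  by rewrite /h normrM indicE ler_piMr //; case: (_ \in _); rewrite ?normr1 ?normr0.
have Eg : (fun x => (g x)%:E) = (fun x => (\sum_(w : n.-tuple bool) (h w x)%:E)%E).
  by apply/funext => x; rewrite gE -sumEFin.
have intg : nu.-integrable setT (fun x => (g x)%:E).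
  by rewrite Eg; apply: integrable_sum.
have Ig : (\int[nu]_x (g x)%:E)%E =
    (\sum_(w : n.-tuple bool) f (extend w) * fine (nu (cyl w)))%:E.
  rewrite Eg integral_sum // -sumEFin; apply: eq_bigr => w _.
  rewrite /h; under eq_integral do rewrite EFinM.
  rewrite integralZl //; last first.
    apply: (@measurable_bounded_integrable _ _ _ nu (\1_(cyl w))) => //.
      by apply: measurable_indic; exact: measurable_cyl.
    exists 1; split => // x Mx y _ /=; apply: le_trans (ltW Mx).
    by rewrite indicE; case: (_ \in _); rewrite ?normr1 ?normr0.
  rewrite integral_indic ?setIT //; last exact: measurable_cyl.
  by rewrite EFinM fineK // submeasure_cyl_fin.
have fIf := integrable_fin_num measurableT intf.
split => //.
have dif : (\int[nu]_x ((f x)%:E - (g x)%:E) =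
    \int[nu]_x (f x)%:E - \int[nu]_x (g x)%:E)%E by exact: integralB_EFin.
rewrite -lee_fin; apply: (@le_trans _ _ (\int[nu]_x `|(f x)%:E - (g x)%:E|)%E).
  apply: le_trans (le_abse_integral _ measurableT _); last first.
    by apply: emeasurable_funB; [exact/measurable_EFinP|case/integrableP: intg].
  rewrite dif Ig -[X in (_ <= `|X - _|)%E](fineK fIf) -EFinB /=; exact: lexx.
apply: (@le_trans _ _ (\int[nu]_x (cst e%:E) x)%E).
  apply: ge0_le_integral => //.
  - apply: measurableT_comp => //.
    by apply: emeasurable_funB; [exact/measurable_EFinP|case/integrableP: intg].
  - by move=> x _; rewrite -EFinB /= lee_fin ltW // fe //; exact: agree_extend.
rewrite integral_cst //; apply: le_trans (_ : e%:E * 1 <= _)%E; last by rewrite mule1.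
by rewrite lee_wpmul2l // lee_fin.
Qed.

End WeakConvergence.

Lemma weak_cvg_cyl (R : realType) (nu : nat -> {measure set biseq -> \bar R})
    (mu : probability biseq R) :
  (forall i, (nu i setT <= 1)%E) ->
  (forall s, fine (nu i (cyl s)) @[i --> \oo] --> fine (mu (cyl s))) ->
  weak_cvg nu mu.
Proof.
move=> nu1 cv f cf.
have mu1 : (mu setT <= 1)%E by rewrite probability_setT.
have fin e : 0 < e -> exists n, forall x y, agree n x y -> `|f x - f y| < e.
  exact: continuous_biseq_uniform.
have [n0 n0P] := fin 1 ltr01.
have [fmu _] := integral_cyl_sum mu1 cf n0P.
rewrite -(fineK fmu); apply/fine_cvgP; split.
  by apply: nearW => i; have [] := integral_cyl_sum (nu1 i) cf n0P.
apply/cvgrPdist_le => e e0; have e3 : 0 < e / 3 by rewrite divr_gt0.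
have [n nP] := fin _ e3.
have : (\sum_(w : n.-tuple bool) f (extend w) * fine (nu i (cyl w)))
    @[i --> \oo] --> \sum_(w : n.-tuple bool) f (extend w) * fine (mu (cyl w)).
  apply: (@cvg_sumR R (n.-tuple bool)
    (fun i w => f (extend w) * fine (nu i (cyl w)))) => w.
  by apply: cvgMl_tmp; exact: cv.
move/cvgrPdist_le => /(_ _ e3); apply: filterS => i.
have [_] := integral_cyl_sum (nu1 i) cf nP.
have [_] := integral_cyl_sum mu1 cf nP.
rewrite /=; move: (fine _) (\sum_(w : _) _) (fine _) (\sum_(w : _) _) => a b c d.
rewrite !ler_norml; lra.
Qed.

(** * Limits of empirical frequencies *)

Lemma negligible_bigcup_count (I : countType) d (T : measurableType d)
    (R : realFieldType) (mu : {measure set T -> \bar R}) (D : set I)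
    (F : I -> set T) :
  (forall s, D s -> mu.-negligible (F s)) ->
  mu.-negligible (\bigcup_(s in D) F s).
Proof.
move=> muF; rewrite bigcup_countE; apply: negligible_bigcup => k.
case: (unpickle k) => [s|]; last exact: negligible_set0.
by case: asboolP => [/muF //|_]; exact: negligible_set0.
Qed.

Section FiniteWindow.
Context {R : realType}.

(** Unlike prefix cylinders, the sets depending on finitely many coordinates are stable under
    preimages by the shift, at the cost of a larger [n] ([window_shift]). *)
Definition window_set (n : nat) (C : set biseq) : Prop :=
  forall x y, agree n x y -> C x -> C y.

Lemma window_setE n C : window_set n C -> C = \bigcup_(w in [set: n.-tuple bool])
  (if `[< C (extend w) >] then cyl w else set0).
Proof.
move=> Cn; apply/seteqP; split=> x.
  move=> Cx; exists (prefix_tuple n x) => //=.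
  rewrite asboolT; last by apply: Cn Cx; exact: agree_extend.
  by rewrite /cyl /= size_prefix_of.
move=> [w _]; case: asboolP => // Cw; rewrite /cyl /= size_tuple => xw.
by apply: Cn Cw; apply/prefix_ofP; rewrite xw -{1}(size_tuple w) prefix_of_extend.
Qed.

Lemma measurable_window n C : window_set n C -> measurable C.
Proof.
move=> /window_setE ->; apply: fin_bigcup_measurable => // w _.
by case: ifP => _; [exact: measurable_cyl|exact: measurable0].
Qed.

Lemma measure_window (mu : {measure set biseq -> \bar R}) n C :
  window_set n C ->
  mu C = (\sum_(w : n.-tuple bool) if `[< C (extend w) >] then mu (cyl w) else 0)%E.
Proof.
move=> /window_setE CE; rewrite {1}CE measure_bigcup_finType.
- by apply: eq_bigr => w _; case: ifP; rewrite ?measure0.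
- by move=> w; case: ifP => _; [exact: measurable_cyl|exact: measurable0].
- move=> v w _ _ [x []]; case: ifP => // _; case: ifP => // _.
  rewrite /cyl /= !size_tuple => -> vw; exact: val_inj.
Qed.

Lemma window_cyl s : window_set (size s) (cyl s).
Proof. by move=> x y /prefix_ofP xy; rewrite /cyl /= xy. Qed.

Lemma window_shift n C : window_set n C ->
  exists m, window_set m (left_shift @^-1` C).
Proof.
move=> Cn; exists (\max_(i < n) (zcode (zidx i + 1)).+1)%N => x y xy.
apply: Cn => i iN; rewrite /left_shift /shiftz.
have := xy (zcode (zidx i + 1)); rewrite zcodeK; apply.
exact: (@leq_bigmax _ (fun i : 'I_n => (zcode (zidx i + 1)).+1) (Ordinal iN)).
Qed.

Lemma measurable_left_shift : measurable_fun setT left_shift.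
Proof.
apply: measurable_fun_biseq => w.
have [n nP] := window_shift (@window_cyl w); exact: measurable_window nP.
Qed.

HB.instance Definition _ := isMeasurableFun.Build _ _ biseq biseq
  left_shift measurable_left_shift.

(** The start [s] is free so that the orbit segment can be a stage window; [s = 1] gives the
    empirical measures ([empiricalE]). *)
Definition efreq (x : biseq) (s L : nat) (C : set biseq) : R :=
  L%:R^-1 * cnt (fun i => `[< C (shiftz (s + i)%N%:Z x) >]) L.

Lemma efreq_ge0 x s L C : 0 <= efreq x s L C.
Proof. by rewrite mulr_ge0 ?invr_ge0 ?cnt_ge0. Qed.

Lemma efreq_le1 x s L C : efreq x s L C <= 1.
Proof.
case: (posnP L) => [->|L0]; first by rewrite /efreq invr0 mul0r.
by rewrite /efreq mulrC ler_pdivrMr ?ltr0n // mul1r cnt_leN.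
Qed.

Lemma efreqT x s L : (0 < L)%N -> efreq x s L setT = 1.
Proof.
move=> L0; rewrite /efreq (eq_cnt (E := predT)); last first.
  by move=> i _; rewrite asboolT.
by rewrite cnt_predT mulVf // pnatr_eq0 -lt0n.
Qed.

Lemma efreq_cyl_rcons x s L w : efreq x s L (cyl w) =
  efreq x s L (cyl (rcons w false)) + efreq x s L (cyl (rcons w true)).
Proof.
rewrite /efreq -mulrDr; congr (_ * _); rewrite /cnt -big_split.
apply: eq_bigr => i _ /=; set y := shiftz _ _; rewrite -natrD; congr _%:R.
have E b : `[< cyl (rcons w b) y >] =
    `[< cyl w y >] && (y (zidx (size w)) == b).
  rewrite /cyl /= size_rcons prefix_of_rcons.
  apply/asboolP/andP => [/eqP|[/asboolP -> /eqP -> //]].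
  by rewrite eqseq_rcons => /andP[/eqP pw ->]; split=> //; apply/asboolP.
by rewrite !E; case: `[< cyl w y >]; case: (y _).
Qed.

Lemma efreq_window x s L n C : window_set n C ->
  efreq x s L C =
  \sum_(w : n.-tuple bool) if `[< C (extend w) >] then efreq x s L (cyl w) else 0.
Proof.
move=> Cn; have -> : \sum_(w : n.-tuple bool)
    (if `[< C (extend w) >] then efreq x s L (cyl w) else 0) =
    L%:R^-1 * \sum_(w : n.-tuple bool) \sum_(0 <= i < L)
      (`[< C (extend w) >] && `[< cyl w (shiftz (s + i)%N%:Z x) >])%:R.
  rewrite mulr_sumr; apply: eq_bigr => w _; case: ifP => // _.
  by rewrite big1 ?mulr0.
congr (_ * _); rewrite exchange_big; apply: eq_bigr => i _.
set y := shiftz _ _; rewrite (bigD1 (prefix_tuple n y)) //= big1 ?addr0.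
  rewrite (_ : `[< cyl _ y >] = true) ?andbT; last first.
    by apply/asboolP; rewrite /cyl /= size_prefix_of.
  congr (_ : bool)%:R; apply/asboolP/asboolP; apply: Cn; first exact: agree_extend.
  by move=> j jn; rewrite -(@agree_extend n y).
move=> w wy; rewrite (_ : `[< cyl _ y >] = false) ?andbF //.
apply/asboolP; rewrite /cyl /= size_tuple => yw.
by case/eqP: wy; apply: val_inj.
Qed.

(** The two counts run over segments that differ by one point at each end. *)
Lemma efreq_shift x s L C :
  `|efreq x s L (left_shift @^-1` C) - efreq x s L C| <= L%:R^-1.
Proof.
rewrite /efreq -mulrBr normrM ger0_norm ?invr_ge0 // ler_piMr ?invr_ge0 //.
have -> : cnt (fun i => `[< (left_shift @^-1` C) (shiftz (s + i)%N%:Z x) >]) L =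
    cnt (fun i => `[< C (shiftz (s + i.+1)%N%:Z x) >]) L :> R.
  apply: eq_cnt => i _ /=; congr (`[< C _ >]).
  rewrite -[left_shift _]/(iter 1 left_shift _) -!iter_shift -iterD.
  by rewrite addnS.
pose D i := `[< C (shiftz (s + i)%N%:Z x) >].
have : cnt D L + (D L)%:R = (D 0%N)%:R + cnt (fun i => D i.+1) L :> R.
  transitivity (\sum_(0 <= i < L.+1) (D i)%:R : R); first by rewrite big_nat_recr.
  by rewrite big_nat_recl.
rewrite -/(D); move: (cnt _ _) (cnt _ _) => a b.
by case: (D L); case: (D 0%N) => /=; rewrite ler_norml; lra.
Qed.

End FiniteWindow.

(** * Invariant measures as limits of frequencies *)

Section LimitMeasure.
Context {R : realType}.
Variables (x : biseq) (s_ L_ : nat -> nat).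
Hypothesis L_oo : (L_ k)%:R^-1 @[k --> \oo] --> (0 : R).
Hypothesis L_gt0 : forall k, (0 < L_ k)%N.
Hypothesis ecvg : forall w,
  cvgn (fun k => efreq (R := R) x (s_ k) (L_ k) (cyl w)).

Lemma ex_limit_measure : exists mu : probability biseq R,
  invariant_on (orbit_closure x) mu /\
  forall n C, window_set n C ->
    efreq x (s_ k) (L_ k) C @[k --> \oo] --> fine (mu C).
Proof.
pose m w : R := limn (fun k => efreq x (s_ k) (L_ k) (cyl w)).
have [mu muE] : exists mu : probability biseq R, forall w, mu (cyl w) = (m w)%:E.
  apply: ex_cyl_prob.
  - move=> w; apply: limr_ge; first exact: ecvg.
    by apply: nearW => k; exact: efreq_ge0.
  - apply: cvg_lim => //; apply: cvg_near_cst; apply: nearW => k.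
    by rewrite (_ : cyl [::] = setT) ?efreqT //; apply/seteqP.
  - move=> w; rewrite /m -limD; [|exact: ecvg|exact: ecvg].
    by congr (limn _); apply/funext => k; exact: efreq_cyl_rcons.
have win n C : window_set n C ->
    efreq x (s_ k) (L_ k) C @[k --> \oo] --> fine (mu C).
  move=> Cn; rewrite (measure_window mu Cn).
  under eq_cvg do rewrite (efreq_window _ _ _ Cn).
  have -> : fine (\sum_(w : n.-tuple bool)
      (if `[< C (extend w) >] then mu (cyl w) else 0))%E =
      \sum_(w : n.-tuple bool) (if `[< C (extend w) >] then m w else 0).
    have -> : (\sum_(w : n.-tuple bool)
        (if `[< C (extend w) >] then mu (cyl w) else 0) =
      \sum_(w : n.-tuple bool) (if `[< C (extend w) >] then m w else 0)%:E)%E.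
      by apply: eq_bigr => w _; case: ifP => // _; rewrite muE.
    by rewrite sumEFin.
  apply: (@cvg_sumR R (n.-tuple bool) (fun k w => if `[< C (extend w) >]
    then efreq x (s_ k) (L_ k) (cyl w) else 0)) => w.
  by case: ifP => _; [exact: ecvg|exact: cvg_cst].
exists mu; split; last exact: win.
split.
  (* The complement of the orbit closure is a countable union of cylinders that no shift of [x]
     enters, so their limit frequencies are 0. *)
  have oC : open (~` orbit_closure x) by rewrite openC; exact: closed_closure.
  have mC : measurable (~` orbit_closure x) by exact: sub_sigma_algebra.
  have mX : measurable (orbit_closure x).
    by rewrite -[X in measurable X]setCK; exact: measurableC.
  have null : mu (~` orbit_closure x) = 0%E.
    apply: measure_negligible => //; rewrite (open_biseqE oC).
    apply: negligible_bigcup_count => w wC.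
    apply/negligibleP; first exact: measurable_cyl.
    apply: (eq_trans (muE w)); congr EFin; apply: cvg_lim => //.
    apply: cvg_near_cst; apply: nearW => j; rewrite /efreq /cnt big1 ?mulr0 // => i _.
    rewrite (_ : `[< _ >] = false) //; apply/asboolP => /wC; apply.
    by apply: subset_closure; exists (s_ j + i)%N%:Z.
  have := probability_setC mu mX; rewrite null => /esym/eqP.
  rewrite sube_eq ?fin_num_measure // add0e => /eqP //.
move=> A mA.
(* It is enough to compare on cylinders, where by [efreq_shift] the frequencies of the set and of
   its preimage differ by at most [1 / L_ k]. *)
apply: (@measure_cyl_unique R (distribution mu left_shift) mu) => //.
  exact: (le_lt_trans (probability_le1 _ measurableT) (ltry _)).
move=> w; have [n nP] := window_shift (@window_cyl w).
have finmu D : measurable D -> mu D \is a fin_num by exact: fin_num_measure.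
suff E : fine (mu (left_shift @^-1` cyl w)) = fine (mu (cyl w)).
  apply: (eq_trans (esym (fineK (finmu _ (measurable_window nP))))).
  by rewrite E (fineK (finmu _ (measurable_cyl w))).
apply/eqP; rewrite -subr_eq0; apply/eqP.
have d1 := cvgB (win _ _ nP) (win _ _ (@window_cyl w)).
transitivity (limn (fun k => efreq x (s_ k) (L_ k) (left_shift @^-1` cyl w) -
    efreq x (s_ k) (L_ k) (cyl w)) : R).
  by apply/esym/cvg_lim => //; exact: d1.
apply: cvg_lim => //.
apply/cvgrPdist_le => e e0; have /cvgrPdist_le/(_ e e0) := L_oo.
apply: filterS => k; rewrite !sub0r !normrN => Lk.
apply: le_trans (efreq_shift _ _ _ _) _.
by rewrite ger0_norm ?invr_ge0 in Lk.
Qed.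

End LimitMeasure.

(** * Diagonal extraction *)

Section DiagonalSubsequence.
Context {R : realType}.

Lemma increasing_seq_ge (f : nat -> nat) k : increasing_seq f -> (k <= f k)%N.
Proof.
move=> /increasing_seqP fI; elim: k => // k IHk.
exact: leq_ltn_trans IHk (fI k).
Qed.

Lemma diagonal_subsequence (I : countType) (e : nat -> I -> R) :
  (forall k i, 0 <= e k i <= 1) ->
  exists2 phi : nat -> nat, increasing_seq phi &
    forall i, cvgn (fun k => e (phi k) i).
Proof.
move=> e01.
have [G GP] : {G : (nat -> nat) * nat -> nat -> nat & forall p,
    increasing_seq (G p) /\ forall i, unpickle p.2 = Some i ->
    cvgn (fun k => e (p.1 (G p k)) i)}.
  apply: (@choice _ _ (fun p g => increasing_seq g /\ forall i,
    unpickle p.2 = Some i -> cvgn (fun k => e (p.1 (g k)) i))) => -[f n].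
  case E : (unpickle n) => [i|]; last by exists id; split.
  have [g gI gc] : exists2 g : nat -> nat, increasing_seq g &
      cvgn ((fun k => e (f k) i) \o g).
    apply: bolzano_weierstrass; exists 1; split => // M M1 k _ /=.
    by have /andP[e0 e1] := e01 (f k) i; rewrite ger0_norm // (le_trans e1) // ltW.
  by exists g; split => // j [<-].
(* [F n.+1] refines [F n] so that the coordinate with code [n] converges along it. *)
pose F := fix F n := if n is m.+1 then fun k => F m (G (F m, m) k) else id.
have FS n k : F n.+1 k = F n (G (F n, n) k) by [].
have FI n : increasing_seq (F n).
  elim: n => // n IHn a b; rewrite FS IHn.
  by have [gI _] := GP (F n, n); exact: gI.
have comp m d : exists2 h : nat -> nat, increasing_seq h &
    forall k, F (m + d)%N k = F m (h k).
  elim: d => [|d [h hI hE]]; first by exists id => // k; rewrite addn0.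
  have [gI _] := GP (F (m + d)%N, (m + d)%N).
  exists (fun k => h (G (F (m + d)%N, (m + d)%N) k)).
    by move=> a b; rewrite hI; exact: gI.
  by move=> k; rewrite addnS FS hE.
exists (fun k => F k k).
  apply/increasing_seqP => k; rewrite FS.
  have [gI _] := GP (F k, k).
  apply: (@leq_trans (F k k.+1)).
    by move: (FI k k.+1 k); rewrite !leEnat ltnn => /negbT; rewrite -ltnNge.
  by rewrite -leEnat FI; exact: increasing_seq_ge.
move=> i; have [_ /(_ i)] := GP (F (pickle i), pickle i).
rewrite /= pickleK => /(_ erefl) /cvg_ex[l cl].
apply/cvg_ex; exists l; apply/cvgrPdist_le => eps eps0.
have /cvgrPdist_le/(_ eps eps0)[N _ NP] := cl.
(* Past [pickle i] the diagonal takes its values along [F (pickle i).+1], at indices [h k >= k]. *)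
exists (maxn N (pickle i).+1) => // k /=; rewrite geq_max => /andP[Nk ik].
have [h hI hE] := comp (pickle i).+1 (k - (pickle i).+1)%N.
rewrite -{1}(subnKC ik) hE FS; apply: NP.
exact: leq_trans Nk (increasing_seq_ge _ hI).
Qed.

End DiagonalSubsequence.

Section Empirical.
Context {R : realType}.

Lemma empiricalE (x : biseq) (N : nat) (C : set biseq) :
  empirical R x N C = (efreq x 1 N C)%:E.
Proof.
rewrite /empirical /mscale /msum /= /efreq /cnt EFinM -sumEFin.
congr (_ * _)%E; rewrite big_mkord; apply: eq_bigr => i _.
rewrite -[left_shift _]/(iter i.+1 left_shift x) iter_shift.
transitivity ((\1_C (shiftz i.+1%:Z x))%:E : \bar R) => //.
Qed.

Lemma weak_cvg_empirical (x : biseq) (N_ : nat -> nat)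
    (mu : probability biseq R) :
  (forall w, efreq x 1 (N_ k) (cyl w) @[k --> \oo] --> fine (mu (cyl w))) ->
  weak_cvg (fun k => empirical R x (N_ k)) mu.
Proof.
move=> cw; apply: weak_cvg_cyl => [k|w].
  by rewrite [X in (X <= _)%E]empiricalE lee_fin efreq_le1.
have -> : (fun k => fine (empirical R x (N_ k) (cyl w))) =
    (fun k => efreq x 1 (N_ k) (cyl w)).
  by apply/funext => k; rewrite [X in fine X]empiricalE.
exact: cw.
Qed.

End Empirical.

(** * Entropy *)

Section Fekete.
Context {R : realType}.

(** The limit is the infimum of [u n / n] over [n > 0]. Division of [n] by [m] gives
    [u n <= n * v m + C] with [C] independent of [n]; it contains [u 0], which may be positive. *)
Lemma fekete_cvg (u : nat -> R) : (forall n, 0 <= u n) ->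
  (forall m n, u (m + n)%N <= u m + u n) -> cvgn (fun n => n%:R^-1 * u n).
Proof.
move=> u0 uD; pose v n := n%:R^-1 * u n.
have v0 n : 0 <= v n by rewrite mulr_ge0 ?invr_ge0.
have uM m q : u (q * m)%N <= q%:R * u m + u 0%N.
  elim: q => [|q IHq]; first by rewrite mul0n mul0r add0r.
  rewrite mulSn -natr1 mulrDl mul1r; apply: le_trans (uD _ _) _.
  by rewrite addrC addrAC lerD2r.
have u1 r : u r <= r%:R * u 1%N + u 0%N by rewrite -{1}(muln1 r); exact: uM.
pose l := inf (v @` [set n | (0 < n)%N]).
have lbV : has_lbound (v @` [set n | (0 < n)%N]) by exists 0 => _ [n _ <-].
have infV : has_inf (v @` [set n | (0 < n)%N]).
  by split=> //; exists (v 1%N); exists 1%N.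
apply/cvg_ex; exists l; apply/cvgrPdist_le => e e0.
have [_ [m /= m0 <-] vm] : exists2 y, (v @` [set n | (0 < n)%N]) y & y < l + e / 2.
  by have [y Vy yl] := inf_adherent (divr_gt0 e0 (ltr0Sn R 1)) infV; exists y.
pose C := 2 * u 0%N + m%:R * u 1%N.
have C0 : 0 <= C by rewrite addr_ge0 // mulr_ge0.
exists (Num.trunc (2 * C / e)).+1 => // n /= nC.
have n0 : (0 < n)%N by apply: leq_trans nC.
have n0R : 0 < n%:R :> R by rewrite ltr0n.
have ln : l <= v n by apply: ge_inf => //; exists n.
have Cn : C <= e / 2 * n%:R.
  have : 2 * C / e < n%:R.
    by apply: lt_le_trans (truncnS_gt _) _; rewrite ler_nat.
  by rewrite ltr_pdivrMr // => /ltW; lra.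
have un : u n <= n%:R * v m + C.
  rewrite {1}(divn_eq n m); apply: le_trans (uD _ _) _.
  have h1 := uM m (n %/ m)%N; have h2 := u1 (n %% m)%N.
  have h3 : (n %/ m)%N%:R * u m <= n%:R * v m.
    rewrite /v mulrA ler_wpM2r // ler_pdivlMr ?ltr0n // -natrM ler_nat.
    exact: leq_trunc_div.
  have h4 : (n %% m)%N%:R * u 1%N <= m%:R * u 1%N.
    by rewrite ler_wpM2r // ler_nat ltnW // ltn_mod.
  by rewrite /C; lra.
have vn : v n <= v m + e / 2.
  rewrite /v -/(v m) mulrC ler_pdivrMr //; apply: le_trans un _.
  by rewrite mulrDl [v m * _]mulrC lerD2l.
rewrite -/(v n) ler_norml; move: (v n) (v m) ln vn vm => a b; lra.
Qed.

End Fekete.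

(** * Shannon entropy of finite distributions *)

Section FiniteEntropy.
Context {R : realType}.

Definition fin_entropy (I : finType) (p : I -> R) : R :=
  - \sum_i p i * ln (p i).

(** This is [ln y <= y - 1] at [y = b / a], multiplied by [a]; equivalently, the tangent at [b] lies
    above the concave function [- a * ln a] of [a]. *)
Lemma mul_ln_le (a b : R) : 0 <= a -> 0 < b -> a * ln b - a * ln a <= b - a.
Proof.
rewrite le_eqVlt => /predU1P[<-|a0] b0; first by rewrite !mul0r !subr0 ltW.
have := @le_ln1Dx R (b / a - 1); rewrite ltrBrDl subrr divr_gt0 // => /(_ isT).
rewrite addrC subrK ln_div ?posrE // => h.
by rewrite -mulrBr -(ler_pdivlMl _ _ a0) mulrBr mulVf ?gt_eqF // [_ * b]mulrC.
Qed.

Lemma xlnx_le0 (a : R) : 0 <= a <= 1 -> a * ln a <= 0.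
Proof. by move=> /andP[a0 a1]; rewrite mulr_ge0_le0 // ln_le0. Qed.

Lemma fin_entropy_ge0 (I : finType) (p : I -> R) :
  (forall i, 0 <= p i <= 1) -> 0 <= fin_entropy p.
Proof.
by move=> p01; rewrite oppr_ge0 sumr_le0 // => i _; exact: xlnx_le0.
Qed.

Lemma fin_entropy_pushforward (I U : finType) (L : I -> U) (p : I -> R)
    (pu : U -> R) : (forall u, pu u = \sum_(i | L i == u) p i) ->
  \sum_i p i * ln (pu (L i)) = \sum_u pu u * ln (pu u).
Proof.
move=> puE; rewrite (partition_big L predT) //=; apply: eq_bigr => u _.
rewrite [X in _ = X * _]puE mulr_suml.
by apply: eq_bigr => i /eqP ->.
Qed.

(** Gibbs' inequality between [p] and the product of its marginals. Injectivity embeds [I] in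
    [U * V], so the masses [pu (L i) * pv (M i)] sum to at most 1. *)
Lemma fin_entropy_subadd (I U V : finType) (L : I -> U) (M : I -> V)
    (p : I -> R) (pu : U -> R) (pv : V -> R) :
  injective (fun i => (L i, M i)) ->
  (forall i, 0 <= p i) -> \sum_i p i = 1 ->
  (forall u, pu u = \sum_(i | L i == u) p i) ->
  (forall v, pv v = \sum_(i | M i == v) p i) ->
  fin_entropy p <= fin_entropy pu + fin_entropy pv.
Proof.
move=> LMinj p0 p1 puE pvE.
have su : \sum_u pu u = 1.
  by rewrite -p1 (partition_big L predT) //=; apply: eq_bigr => u _; rewrite puE.
have sv : \sum_v pv v = 1.
  by rewrite -p1 (partition_big M predT) //=; apply: eq_bigr => v _; rewrite pvE.
have pu0 u : 0 <= pu u by rewrite puE sumr_ge0.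
have pv0 v : 0 <= pv v by rewrite pvE sumr_ge0.
have ppu i : p i <= pu (L i).
  by rewrite puE (bigD1 i) //= lerDl sumr_ge0.
have ppv i : p i <= pv (M i).
  by rewrite pvE (bigD1 i) //= lerDl sumr_ge0.
rewrite /fin_entropy -(fin_entropy_pushforward puE) -(fin_entropy_pushforward pvE).
rewrite -opprD lerN2 -big_split /= -subr_le0 -sumrB.
apply: (@le_trans _ _ (\sum_i (pu (L i) * pv (M i) - p i))).
  apply: ler_sum => i _; have := p0 i; rewrite le_eqVlt => /predU1P[<-|pi].
    by rewrite !mul0r addr0 !subr0 mulr_ge0.
  have pui : 0 < pu (L i) := lt_le_trans pi (ppu i).
  have pvi : 0 < pv (M i) := lt_le_trans pi (ppv i).
  rewrite -mulrDr -lnM ?posrE //; apply: mul_ln_le => //.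
  exact: mulr_gt0.
rewrite sumrB p1 subr_le0.
have -> : 1 = \sum_(x : U * V) pu x.1 * pv x.2.
  rewrite -(pair_big xpredT xpredT (fun u v => pu u * pv v)) /=.
  by under eq_bigr do rewrite -mulr_sumr sv mulr1; rewrite su.
rewrite -(big_map (fun i => (L i, M i)) xpredT (fun x => pu x.1 * pv x.2)).
rewrite big_uniq ?map_inj_uniq ?index_enum_uniq //=.
rewrite [leRHS](bigID (mem [seq (L i, M i) | i <- index_enum I])) /= lerDl.
by apply: sumr_ge0 => x _; rewrite mulr_ge0.
Qed.

(* Concavity of -x ln x, with part of the mass of s left unspecified. *)
Lemma xlnx_mixture (J : eqType) (r : seq J) (w t : J -> R) (s : R) :
  (forall j, 0 <= w j) -> (forall j, 0 <= t j) -> \sum_(j <- r) w j <= 1 ->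
  \sum_(j <- r) w j * t j <= s <=
    \sum_(j <- r) w j * t j + (1 - \sum_(j <- r) w j) ->
  \sum_(j <- r) w j * - (t j * ln (t j)) <= - (s * ln s).
Proof.
move=> w0 t0 w1 /andP[s1s ss1].
set W := \sum_(j <- r) w j in w1 ss1.
set s1 := \sum_(j <- r) w j * t j in s1s ss1.
have s10 : 0 <= s1 by apply: sumr_ge0 => j _; rewrite mulr_ge0.
have [s0|s0] := ltrP 0 s.
  (* The tangent at [s], weighted by [w j]. *)
  have step j : w j * - (t j * ln (t j)) <=
      - ln s * (w j * t j) + s * w j - w j * t j.
    have := ler_wpM2l (w0 j) (mul_ln_le (t0 j) s0).
    by rewrite !mulrBr; move: (ln s) (ln (t j)) => x y; lra.
  apply: le_trans (ler_sum _ (fun j _ => step j)) _.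
  rewrite sumrB big_split /= -!mulr_sumr -/s1 -/W.
  (* As [s1 <= s], this bound reduces the goal to [s * (s - s1 - (1 - W)) <= 0], which is the upper
     bound on [s]. *)
  have lns : ln s <= s - 1 by have := mul_ln_le ler01 s0; rewrite !mul1r ln1 subr0.
  move: (ln s) lns => x lns; nra.
have s00 : s = 0 by apply/eqP; rewrite eq_le s0 (le_trans s10).
have s1E : s1 = 0 by apply/eqP; rewrite eq_le s10 andbT -s00.
rewrite s00 mul0r oppr0 big_seq big1 // => j jr.
have wt0 : w j * t j = 0.
  apply/eqP; move: s1E; rewrite /s1 => /eqP; rewrite psumr_eq0.
    by move=> /allP/(_ j jr).
  by move=> i _; rewrite mulr_ge0.
by rewrite mulrN mulrA wt0 mul0r oppr0.
Qed.

Lemma fin_entropy_mixture (I : finType) (J : eqType) (r : seq J) (w : J -> R)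
    (t : J -> I -> R) (s : I -> R) :
  (forall j, 0 <= w j) -> (forall j i, 0 <= t j i) ->
  \sum_(j <- r) w j <= 1 ->
  (forall i, \sum_(j <- r) w j * t j i <= s i <=
    \sum_(j <- r) w j * t j i + (1 - \sum_(j <- r) w j)) ->
  \sum_(j <- r) w j * fin_entropy (t j) <= fin_entropy s.
Proof.
move=> w0 t0 w1 sP; rewrite /fin_entropy -sumrN.
under eq_bigr do rewrite -sumrN mulr_sumr.
by rewrite exchange_big /=; apply: ler_sum => i _; exact: xlnx_mixture.
Qed.

Lemma fin_entropy_ge (I : finType) (p : I -> R) (c : R) : 0 < c ->
  (forall i, 0 <= p i <= c) -> \sum_i p i = 1 -> - ln c <= fin_entropy p.
Proof.
move=> c0 pc p1; rewrite /fin_entropy -sumrN -[leLHS]mul1r -p1 mulr_suml.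
apply: ler_sum => i _; rewrite -mulrN; have /andP[+ pic] := pc i.
rewrite le_eqVlt => /predU1P[<-|pi]; first by rewrite !mul0r.
by rewrite ler_pM2l // lerN2 ler_ln ?posrE.
Qed.

(** Gives the continuity of [a * ln a] at 0. With [s] the root of [a], it is [2 * s * (s * ln s)],
    and [- s * ln s <= 1 - s]. *)
Lemma xlnx_sqrt (a : R) : 0 <= a <= 1 -> `|a * ln a| <= 2 * Num.sqrt a.
Proof.
move=> /andP[]; rewrite le_eqVlt => /predU1P[<- _|a0 a1].
  by rewrite mul0r normr0 sqrtr0 mulr0.
have s0 : 0 < Num.sqrt a by rewrite sqrtr_gt0.
rewrite ler0_norm; last by rewrite xlnx_le0 // a1 ltW.
have := mul_ln_le (ltW s0) (@ltr01 R); rewrite ln1 mulr0 sub0r.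
have aE := sqr_sqrtr (ltW a0).
have lna : ln a = 2 * ln (Num.sqrt a) by rewrite -{1}aE lnXn // mulr_natl.
rewrite {}lna; move: (Num.sqrt a) s0 aE => s s0 <-.
by move: (ln s) => x h; nra.
Qed.

Lemma cvg_xlnx (u : nat -> R) (l : R) : (forall n, 0 <= u n <= 1) ->
  u n @[n --> \oo] --> l -> u n * ln (u n) @[n --> \oo] --> l * ln l.
Proof.
move=> u01 ul.
have l0 : 0 <= l.
  rewrite -(cvg_lim _ ul) //; apply: limr_ge; first by apply/cvg_ex; exists l.
  by apply: nearW => n; have /andP[] := u01 n.
move: l0; rewrite le_eqVlt => /predU1P[l0|l0]; last first.
  apply: cvgM => //; apply: continuous_cvg => //; exact: continuous_ln.
rewrite -l0 mul0r in ul *.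
have sl : 2 * Num.sqrt (u n) @[n --> \oo] --> 2 * Num.sqrt (0 : R).
  by apply: cvgMl_tmp; apply: (continuous_cvg _ _ ul); exact: sqrt_continuous.
rewrite sqrtr0 mulr0 in sl.
apply/cvgrPdist_le => e e0; have /cvgrPdist_le/(_ e e0) := sl.
apply: filterS => n; rewrite !sub0r !normrN => h.
apply: le_trans (xlnx_sqrt (u01 n)) _; apply: le_trans h.
exact: ler_norm.
Qed.

Lemma cvg_fin_entropy (I : finType) (p : nat -> I -> R) (q : I -> R) :
  (forall n i, 0 <= p n i <= 1) ->
  (forall i, p n i @[n --> \oo] --> q i) ->
  fin_entropy (p n) @[n --> \oo] --> fin_entropy q.
Proof.
move=> p01 pq; apply: cvgN.
apply: (@cvg_big _ _ +%R 0 xpredT add_continuous) => // i _.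
exact: cvg_xlnx.
Qed.

End FiniteEntropy.

(** * Subadditivity of the entropy of joins *)

Section JoinEntropy.
Context {d : measure_display} {T : measurableType d} {R : realType}.
Variables (mu : probability T R) (f : T -> T).
Hypothesis mf : measurable_fun setT f.
Hypothesis mu_inv : forall A, measurable A -> mu (f @^-1` A) = mu A.
Variables (k : nat) (P : 'I_k -> set T).
Hypothesis partP : finite_partition P.

Definition cell_mass n (w : {ffun 'I_n -> 'I_k}) : R :=
  fine (mu (join_cell f P w)).

Lemma join_entropyE n : join_entropy mu f P n = fin_entropy (@cell_mass n).
Proof. by []. Qed.

Lemma measurable_iter n A : measurable A -> measurable (iter n f @^-1` A).
Proof.
move=> mA; elim: n => // n IHn.
rewrite (_ : _ @^-1` _ = f @^-1` (iter n f @^-1` A)).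
  by rewrite -[X in measurable X]setTI; exact: mf.
by apply/funext => x; apply: (congr1 A); exact: iterSr.
Qed.

Lemma measure_iter n A : measurable A -> mu (iter n f @^-1` A) = mu A.
Proof.
move=> mA; elim: n => // n IHn.
rewrite (_ : _ @^-1` _ = f @^-1` (iter n f @^-1` A)).
  by rewrite mu_inv //; exact: measurable_iter.
by apply/funext => x; apply: (congr1 A); exact: iterSr.
Qed.

Lemma measurable_join_cell n (w : {ffun 'I_n -> 'I_k}) :
  measurable (join_cell f P w).
Proof.
have [mP _ _] := partP.
rewrite (_ : join_cell f P w =
  \bigcap_(j in [set: 'I_n]) (iter j f @^-1` P (w j))).
  by apply: fin_bigcap_measurable => // j _; exact: measurable_iter.
by apply/seteqP; split=> x /= h j => [_|]; exact: h.
Qed.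

Lemma trivIset_join_cell n :
  trivIset setT (fun w : {ffun 'I_n -> 'I_k} => join_cell f P w).
Proof.
have [_ tP _] := partP.
move=> v w _ _ [x [/= xv xw]]; apply/ffunP => j.
by apply: tP => //; exists (iter j f x).
Qed.

Lemma bigcup_join_cell n :
  \bigcup_(w : {ffun 'I_n -> 'I_k}) join_cell f P w = setT.
Proof.
have [_ _ cP] := partP; apply/seteqP; split=> // x _.
have ex (j : 'I_n) : exists i, P i (iter j f x).
  by have [i _ Pi] : (\bigcup_i P i) (iter j f x) by [rewrite cP|]; exists i.
have [w wP] := choice ex.
by exists (finfun w) => //= j; rewrite ffunE.
Qed.

Lemma cell_mass_split n A : measurable A ->
  fine (mu A) = \sum_(w : {ffun 'I_n -> 'I_k}) fine (mu (A `&` join_cell f P w)).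
Proof.
move=> mA; have mAw (w : {ffun 'I_n -> 'I_k}) : measurable (A `&` join_cell f P w).
  by apply: measurableI => //; exact: measurable_join_cell.
rewrite -{1}[A]setIT -(bigcup_join_cell n) setI_bigcupr measure_bigcup_finType //.
  by rewrite -sum_fine // => w _; exact: fin_num_measure.
by apply: trivIset_setIl; exact: trivIset_join_cell.
Qed.

Lemma cell_mass_ge0 n (w : {ffun 'I_n -> 'I_k}) : 0 <= cell_mass w.
Proof. by apply: fine_ge0; exact: measure_ge0. Qed.

Lemma cell_mass_sum n : \sum_(w : {ffun 'I_n -> 'I_k}) cell_mass w = 1.
Proof.
have := cell_mass_split n measurableT; rewrite probability_setT /= => ->.
by apply: eq_bigr => w _; rewrite setTI.
Qed.

Lemma cell_mass_le1 n (w : {ffun 'I_n -> 'I_k}) : cell_mass w <= 1.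
Proof.
rewrite -(cell_mass_sum n) (bigD1 w) //= lerDl sumr_ge0 // => v _.
exact: cell_mass_ge0.
Qed.

Definition lword m n (w : {ffun 'I_(m + n) -> 'I_k}) : {ffun 'I_m -> 'I_k} :=
  [ffun j => w (lshift n j)].

Definition rword m n (w : {ffun 'I_(m + n) -> 'I_k}) : {ffun 'I_n -> 'I_k} :=
  [ffun j => w (rshift m j)].

Lemma lword_rword_inj m n :
  injective (fun w : {ffun 'I_(m + n) -> 'I_k} => (lword w, rword w)).
Proof.
move=> v w [/ffunP lE /ffunP rE]; apply/ffunP => j; rewrite -(splitK j).
case: (fintype.split j) => i /=; first by have := lE i; rewrite !ffunE.
by have := rE i; rewrite !ffunE.
Qed.

Lemma join_cellD m n (w : {ffun 'I_(m + n) -> 'I_k}) :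
  join_cell f P w =
  join_cell f P (lword w) `&` iter m f @^-1` join_cell f P (rword w).
Proof.
apply/seteqP; split=> x.
  move=> h; split=> j; first by rewrite ffunE; exact: (h (lshift n j)).
  have <- : iter (m + j) f x = iter j f (iter m f x) by rewrite addnC iterD.
  by rewrite ffunE; exact: (h (rshift m j)).
move=> [hl hr] j; rewrite -(splitK j).
case: (fintype.split j) => i /=; first by have := hl i; rewrite ffunE.
have -> : iter (m + i) f x = iter i f (iter m f x) by rewrite addnC iterD.
by have := hr i; rewrite ffunE.
Qed.

(** A word of length [m + n] is the pair of its two parts. The marginal of the second part is the
    distribution of words of length [n] by invariance of [mu]. *)
Lemma join_entropy_subadd m n :
  join_entropy mu f P (m + n) <= join_entropy mu f P m + join_entropy mu f P n.
Proof.
rewrite !join_entropyE.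
apply: (fin_entropy_subadd (@lword_rword_inj m n)).
- by move=> w; exact: cell_mass_ge0.
- exact: cell_mass_sum.
- move=> u; have mu_ := measurable_join_cell u.
  rewrite {1}/cell_mass (cell_mass_split (m + n) mu_).
  rewrite [RHS]big_mkcond; apply: eq_bigr => w _; case: eqP => [<-|uw].
    by rewrite join_cellD setIA setIid -join_cellD.
  rewrite (_ : _ `&` _ = set0) ?measure0 //; apply/seteqP; split=> // x [xu].
  rewrite join_cellD => -[xl _]; apply: uw.
  by apply: (@trivIset_join_cell m) => //; exists x.
- move=> v; have mv := measurable_join_cell v.
  rewrite {1}/cell_mass -(measure_iter m mv).
  rewrite (cell_mass_split (m + n)); last exact: measurable_iter.
  rewrite [RHS]big_mkcond; apply: eq_bigr => w _; case: eqP => [<-|vw].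
    by rewrite join_cellD setICA setIid -join_cellD.
  rewrite (_ : _ `&` _ = set0) ?measure0 //; apply/seteqP; split=> // x [xv].
  rewrite join_cellD => -[_ xr]; apply: vw.
  by apply: (@trivIset_join_cell n) => //; exists (iter m f x).
Qed.

Lemma join_entropy_cvg : cvgn (fun n => n%:R^-1 * join_entropy mu f P n).
Proof.
apply: fekete_cvg; last exact: join_entropy_subadd.
move=> n; rewrite join_entropyE; apply: fin_entropy_ge0 => w.
by rewrite cell_mass_ge0 cell_mass_le1.
Qed.

Lemma ks_entropy_gt0 (c : R) : 0 < c ->
  (forall n, n%:R * c <= join_entropy mu f P n) -> (0 < ks_entropy mu f)%E.
Proof.
move=> c0 cH; apply: (@lt_le_trans _ _ (partition_entropy mu f P)%:E); last first.
  by apply: ereal_sup_ubound; exists k, P.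
rewrite lte_fin (lt_le_trans c0) // /partition_entropy.
apply: limr_ge; first exact: join_entropy_cvg.
exists 1%N => // n /= n1; rewrite mulrC ler_pdivlMr ?ltr0n // mulrC; exact: cH.
Qed.

End JoinEntropy.

(** * Positive entropy of the limit measures *)

Section CoordinatePartition.

Definition coord_part (i : 'I_2) : set biseq := [set x | x 0 = (i == 1%N :> nat)].

Lemma coord_part_finite_partition : finite_partition coord_part.
Proof.
split.
- by move=> i; apply: sub_sigma_algebra; exact: open_coordinate.
- move=> i j _ _ [x [xi]]; rewrite /coord_part /= xi => ij.
  by apply: val_inj; case: i j ij {xi} => [[|[|]] //= ?] [[|[|]]].
- apply/seteqP; split=> // x _; case E : (x 0).
    by exists (@Ordinal 2 1 isT) => //; rewrite /coord_part /= E.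
  by exists (@Ordinal 2 0 isT) => //; rewrite /coord_part /= E.
Qed.

Definition word_at n (p : nat) (x : biseq) (w : {ffun 'I_n -> 'I_2}) : bool :=
  [forall j : 'I_n, x (p + j)%N%:Z == (w j == 1%N :> nat)].

Lemma join_cell_word n (p : nat) (x : biseq) (w : {ffun 'I_n -> 'I_2}) :
  join_cell left_shift coord_part w (shiftz p%:Z x) <-> word_at p x w.
Proof.
split=> [h|/forallP h j].
  apply/forallP => j; have := h j; rewrite /coord_part /= iter_shift.
  by rewrite /shiftz add0r -PoszD addnC => /eqP.
rewrite /coord_part /= iter_shift /shiftz add0r -PoszD addnC.
exact/eqP.
Qed.

(** The coordinates 0, ..., n - 1 have the even codes up to 2n - 2. *)
Lemma join_cell_window n (w : {ffun 'I_n -> 'I_2}) :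
  window_set (n.*2) (join_cell left_shift coord_part w).
Proof.
move=> x y xy h j; have := h j; rewrite /coord_part /= !iter_shift /shiftz.
rewrite add0r => <-; apply/esym.
have := xy (zcode j%:Z); rewrite zcodeK; apply => /=.
by rewrite ltn_double.
Qed.

Lemma word_at_exists n (p : nat) (x : biseq) :
  exists2 v : {ffun 'I_n -> 'I_2}, word_at p x v &
    forall w, word_at p x w -> w = v.
Proof.
exists [ffun j : 'I_n => if x (p + j)%N%:Z then @Ordinal 2 1 isT else @Ordinal 2 0 isT].
  by apply/forallP => j; rewrite ffunE; case: (x _).
move=> w /forallP xw; apply/ffunP => j; rewrite ffunE; apply: val_inj.
have := xw j; case: (x _) => /eqP/esym; first by move=> /eqP.
by case: (w j) => [[|[|]]].
Qed.

Lemma sum_word_at (R : realType) n (p : nat) (x : biseq) :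
  \sum_(w : {ffun 'I_n -> 'I_2}) (word_at p x w)%:R = 1 :> R.
Proof.
have [v xv uv] := word_at_exists n p x.
rewrite (bigD1 v) //= xv big1 ?addr0 // => w wv.
by case: (boolP (word_at p x w)) => // /uv /eqP; rewrite (negPf wv).
Qed.

End CoordinatePartition.

(** * Entropy of words read in a stage window *)

Section WindowEntropy.
Context {R : realType}.
Variable S : stages R.
Notation Q := (stage_period S).
Notation T := (stage_start S).
Notation E := (stage_end S).
Notation x := (eta (stage_union S)).
Notation Z := (free_residue S).
Notation cnt := (@cnt R).

Definition free_in (k n r z : nat) : bool := Z k z && (r <= z < r + n)%N.

(** Double counting: each free residue in [n, Q k - n) lies in exactly [n] of the intervals [r, r +
    n), and at most [2 * n] residues are left out. *)
Lemma sum_free_in k n : (2 * n <= Q k)%N ->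
  n%:R * (15 / 16 * (Q k)%:R - 2 * n%:R) <=
  \sum_(0 <= r < Q k - n) (count (free_in k n r) (iota 0 (Q k)))%:R :> R.
Proof.
move=> nQ.
have QE : (Q k = n + ((Q k - 2 * n) + n))%N by lia.
apply: (@le_trans _ _ (\sum_(0 <= r < Q k - n) \sum_(0 <= z < Q k - 2 * n)
    (free_in k n r (n + z))%:R)); last first.
  apply: ler_sum => r _; rewrite -sum1_count big_mkcond /= natr_sum.
  rewrite -[X in iota 0 X]subn0 -/(index_iota 0 (Q k)).
  apply: (@le_trans _ _ (cnt (free_in k n r) (Q k))); last first.
    by rewrite [leRHS]big_mkcond; apply: ler_sum => z _; case: (free_in _ _ _ _).
  rewrite [X in cnt _ X]QE cntD cntD; apply: ler_wpDl; first exact: cnt_ge0.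
  by apply: ler_wpDr; first exact: cnt_ge0.
rewrite exchange_big /=.
apply: (@le_trans _ _ (\sum_(0 <= z < Q k - 2 * n) n%:R * (Z k (n + z)%N)%:R)).
  rewrite -mulr_sumr ler_wpM2l //.
  have := cnt_free S k; rewrite [X in cnt _ X]QE cntD cntD.
  have := cnt_leN (R := R) (Z k) n.
  have := cnt_leN (R := R) (fun y => Z k (n + (Q k - 2 * n + y))%N) n.
  rewrite -[X in _ -> _ -> _ -> _ <= X]/(cnt (fun z => Z k (n + z)%N) _).
  by lra.
apply: ler_sum_nat => z /andP[_ zQ].
rewrite /free_in; case: (Z k _); last by rewrite mulr0 sumr_ge0.
rewrite mulr1 /=.
have -> : (Q k - n = z.+1 + (n + (Q k - 2 * n - z.+1)))%N by lia.
rewrite -[leRHS]/(cnt (fun r => r <= n + z < r + n)%N _) cntD cntD.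
apply: ler_wpDl; first exact: cnt_ge0.
apply: ler_wpDr; first exact: cnt_ge0.
rewrite -[leLHS](@cnt_predT R); apply: cnt_le => r rn _; lia.
Qed.

(** The law of the word at offset [r] in a block chosen uniformly among the [2 ^ Q k] blocks of the
    window. *)
Definition slot_mass k n r (w : {ffun 'I_n -> 'I_2}) : R :=
  (2 ^+ Q k)^-1 * cnt (fun j => word_at (T k + (j * Q k + r)) x w) (2 ^ Q k).

Lemma slot_mass_sum k n r :
  \sum_(w : {ffun 'I_n -> 'I_2}) slot_mass k r w = 1 :> R.
Proof.
rewrite -mulr_sumr /cnt exchange_big /=.
under eq_bigr do rewrite sum_word_at.
by rewrite sumr_const_nat subn0 natrX mulVf // expf_neq0 // pnatr_eq0.
Qed.

(** The word prescribes the digits of [j] at the free residues of [r, r + n), while [j] runs through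
    all digit patterns. *)
Lemma slot_mass_le k n r (w : {ffun 'I_n -> 'I_2}) : (r + n <= Q k)%N ->
  slot_mass k r w <= (2 ^+ count (free_in k n r) (iota 0 (Q k)))^-1.
Proof.
move=> rn; have p2 m : 0 < 2 ^+ m :> R by rewrite exprn_gt0.
rewrite /slot_mass ler_pdivrMl // ler_pdivlMr //.
(* The digit that [w] imposes at residue [z], negated because [eta] is the negation of the digit. *)
pose g z := if insub (z - r)%N is Some j then ~~ (w j == 1%N :> nat) else false.
rewrite -(cnt_digits_match (free_in k n r) g (Q k)).
apply: ler_wpM2r; first exact: ltW.
apply: cnt_le => j j2 /forallP wj; apply/allP => z; rewrite mem_iota => /= zQ.
apply/implyP => /andP[Zz /andP[rz zrn]].
have zr : (z - r < n)%N by lia.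
have := wj (Ordinal zr); rewrite /g insubT /=.
rewrite (_ : T k + (j * Q k + r) + (z - r) = T k + (j * Q k + z))%N; last by lia.
by rewrite eta_window // => /eqP <-; rewrite negbK.
Qed.

Lemma slot_entropy_ge k n r : (r + n <= Q k)%N ->
  (count (free_in k n r) (iota 0 (Q k)))%:R * ln 2 <=
  fin_entropy (fun w : {ffun 'I_n -> 'I_2} => slot_mass k r w).
Proof.
move=> rn; set m := count _ _.
have p2 : 0 < 2 ^+ m :> R by rewrite exprn_gt0.
have -> : m%:R * ln 2 = - ln (2 ^+ m)^-1 :> R.
  by rewrite lnV ?posrE // opprK lnXn // mulr_natl.
apply: fin_entropy_ge; first by rewrite invr_gt0.
- move=> w; rewrite slot_mass_le // andbT.
  by apply: mulr_ge0; rewrite ?cnt_ge0 // invr_ge0 exprn_ge0.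
- exact: slot_mass_sum.
Qed.

(** The starting positions in the stage window are grouped by residue [r < Q k - n], so that each
    word stays inside a block. Concavity averages the slot entropies; all other starting positions
    are the unspecified mass in [fin_entropy_mixture]. *)
Lemma window_entropy_ge k n s L : (8 * n <= Q k)%N -> (s <= T k)%N ->
  (E k <= s + L)%N -> (L <= 2 * (2 ^ Q k * Q k))%N ->
  n%:R * (ln 2 / 4) <= fin_entropy (fun w : {ffun 'I_n -> 'I_2} =>
    efreq (R := R) x s L (join_cell left_shift coord_part w)).
Proof.
move=> nQ sT EL L2.
have Q0 := stage_period_gt0 S k.
set W := (2 ^ Q k * Q k)%N in L2; have EW : E k = (T k + W)%N by [].
have W0 : (0 < W)%N by rewrite muln_gt0 expn_gt0.
have L0 : (0 < L)%N by lia.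
have LR : 0 < L%:R :> R by rewrite ltr0n.
have nQ' : (n <= Q k)%N by lia.
(* The share of one residue class of starting positions in [s, s + L). *)
pose c : R := 2 ^+ Q k / L%:R.
have c0 : 0 <= c by rewrite divr_ge0 // exprn_ge0.
have cE : \sum_(r <- iota 0 (Q k - n)) c = L%:R^-1 * (2 ^ Q k * (Q k - n))%N%:R.
  rewrite big_const_seq count_predT size_iota iter_addr addr0.
  by rewrite -[c *+ _]mulr_natr /c natrM natrX; ring.
have slotE (w : {ffun 'I_n -> 'I_2}) :
    \sum_(r <- iota 0 (Q k - n)) c * slot_mass k r w = L%:R^-1 *
    \sum_(0 <= j < 2 ^ Q k)
      cnt (fun r => word_at (T k + (j * Q k + r)) x w) (Q k - n).
  rewrite /cnt exchange_big /= mulr_sumr /index_iota subn0; apply: eq_bigr => r _.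
  rewrite /c /slot_mass mulrA; congr (_ * _).
  by rewrite mulrC mulrA mulVf ?mul1r // expf_neq0.
apply: le_trans (fin_entropy_mixture (r := iota 0 (Q k - n)) (w := fun=> c)
  (t := fun r w => slot_mass k r w) _ _ _ _).
- rewrite -mulr_sumr.
  apply: (@le_trans _ _ (c * \sum_(r <- iota 0 (Q k - n))
      (count (free_in k n r) (iota 0 (Q k)))%:R * ln 2)); last first.
    rewrite ler_wpM2l // big_seq [leRHS]big_seq; apply: ler_sum => r.
    by rewrite mem_iota => rQ; apply: slot_entropy_ge; lia.
  have l2 : 0 < ln 2 :> R by rewrite ln_gt0 // ltr1n.
  rewrite -mulr_suml; set sm := \sum_(r <- _) _.
  (* [8 * n <= Q k] leaves a proportion 15/16 - 1/4 >= 1/2 in [sum_free_in]. *)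
  have sf : n%:R * ((Q k)%:R / 2) <= sm.
    have := @sum_free_in k n; rewrite /index_iota subn0 -/sm => /(_ _).
    have -> : (2 * n <= Q k)%N by lia.
    move=> /(_ isT); apply: le_trans; apply: ler_wpM2l => //.
    have : 8 * n%:R <= (Q k)%:R :> R by rewrite -natrM ler_nat.
    by have := ler0n R (Q k); lra.
  have cQ : 1 / 2 <= c * (Q k)%:R.
    rewrite /c mulrAC ler_pdivlMr // -natrX -natrM.
    have : L%:R <= 2 * W%:R :> R by rewrite -natrM ler_nat.
    by rewrite /W; lra.
  have nc : n%:R / 4 <= c * sm.
    apply: le_trans (ler_wpM2l c0 sf).
    have -> : c * (n%:R * ((Q k)%:R / 2)) = (c * (Q k)%:R) * (n%:R / 2) by ring.
    apply: (@le_trans _ _ (1 / 2 * (n%:R / 2))); first by lra.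
    by apply: ler_wpM2r.
  have -> : n%:R * (ln 2 / 4) = n%:R / 4 * ln 2 :> R by ring.
  by rewrite mulrA; apply: ler_wpM2r => //; exact: ltW.
- by [].
- by move=> r w; apply: mulr_ge0; rewrite ?cnt_ge0 // invr_ge0 exprn_ge0.
- rewrite cE mulrC ler_pdivrMr // mul1r ler_nat.
  by apply: (@leq_trans W); [rewrite /W leq_mul2l leq_subr orbT|lia].
move=> w; rewrite slotE cE /efreq.
pose D i := word_at (s + i) x w.
rewrite (@eq_cnt R _ D); last first.
  by move=> i _; apply/asboolP/idP => /join_cell_word.
set a := \sum_(0 <= j < _) _.
have K0 : (2 ^ Q k * (Q k - n) <= L)%N.
  by apply: (@leq_trans W); [rewrite /W leq_mul2l leq_subr orbT|lia].
(* The uncontrolled positions are those before and after the stage window and the last [n] of each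
   block. *)
have key : a <= cnt D L <= a + (L - 2 ^ Q k * (Q k - n))%N%:R.
  have LE : L = ((T k - s) + (W + (L - W - (T k - s))))%N by lia.
  have DE y : D (T k - s + y)%N = word_at (T k + y) x w.
    by rewrite /D; congr (word_at _ x w); lia.
  have mid : cnt (fun i => D (T k - s + i)%N) W = a + \sum_(0 <= j < 2 ^ Q k)
      cnt (fun r => word_at (T k + (j * Q k + (Q k - n + r))) x w) n.
    rewrite /W cnt_blocks /a -big_split; apply: eq_bigr => j _.
    rewrite /= -[X in cnt _ X = _](subnK nQ') cntD.
    by congr (_ + _); apply: eq_cnt => z _; exact: DE.
  rewrite {1 2}LE !cntD mid.
  have t1 := cnt_leN (R := R) D (T k - s).
  have t2 := cnt_ge0 (R := R) D (T k - s).
  set c2 := cnt _ (L - W - _).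
  have t3 : c2 <= (L - W - (T k - s))%N%:R by exact: cnt_leN.
  have t4 : 0 <= c2 by exact: cnt_ge0.
  set b := \sum_(0 <= j < _) _.
  have b0 : 0 <= b by apply: sumr_ge0 => j _; exact: cnt_ge0.
  have b1 : b <= (2 ^ Q k * n)%N%:R.
    apply: (@le_trans _ _ (\sum_(0 <= j < 2 ^ Q k) n%:R)).
      by apply: ler_sum => j _; exact: cnt_leN.
    by rewrite sumr_const_nat subn0 -mulrnA [(n * _)%N]mulnC.
  have -> : (L - 2 ^ Q k * (Q k - n) =
      (T k - s) + (L - W - (T k - s)) + 2 ^ Q k * n)%N.
    rewrite mulnBr -/W; have : (2 ^ Q k * n <= W)%N by rewrite leq_mul2l nQ' orbT.
    by lia.
  by rewrite !natrD; lra.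
move: key; rewrite natrB // => /andP[k1 k2].
rewrite ler_wpM2l ?invr_ge0 //=.
have -> : L%:R^-1 * a + (1 - L%:R^-1 * (2 ^ Q k * (Q k - n))%N%:R) =
    L%:R^-1 * (a + (L%:R - (2 ^ Q k * (Q k - n))%N%:R)).
  by rewrite [RHS]mulrDr mulrBr mulVf ?gt_eqF.
by rewrite ler_wpM2l ?invr_ge0.
Qed.

End WindowEntropy.

Section EntropyMeasure.
Context {R : realType}.
Variable S : stages R.
Notation Q := (stage_period S).
Notation T := (stage_start S).
Notation E := (stage_end S).
Notation x := (eta (stage_union S)).

Lemma cvg_inv_nat (u : nat -> nat) : (forall k, (k <= u k)%N) ->
  (u k)%:R^-1 @[k --> \oo] --> (0 : R).
Proof.
move=> uk; apply/cvgrPdist_le => e e0.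
exists (Num.trunc e^-1).+1 => // k /= ek.
have k0 : 0 < k%:R :> R by rewrite ltr0n; apply: leq_trans ek.
have ku : k%:R <= (u k)%:R :> R by rewrite ler_nat.
rewrite sub0r normrN ger0_norm ?invr_ge0 //.
apply: (@le_trans _ _ k%:R^-1); first by rewrite lef_pV2 ?posrE // (lt_le_trans k0).
rewrite -[leRHS]invrK lef_pV2 ?posrE ?invr_gt0 //.
by apply: ltW; apply: lt_le_trans (truncnS_gt _) _; rewrite ler_nat.
Qed.

(** The segments contain the stage windows in a proportion at least 1/2. Along a subsequence all
    cylinder frequencies converge, and the bound of [window_entropy_ge] passes to the limit for each
    fixed [n]. *)
Lemma stage_entropy_measure (s_ L_ : nat -> nat) :
  (forall k, (s_ k <= T k)%N) -> (forall k, (E k <= s_ k + L_ k)%N) ->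
  (forall k, (L_ k <= 2 * (2 ^ Q k * Q k))%N) -> (forall k, (k < L_ k)%N) ->
  exists phi : nat -> nat, exists mu : probability biseq R,
    [/\ increasing_seq phi, invariant_on (orbit_closure x) mu,
        has_positive_entropy mu &
        forall w, efreq x (s_ (phi k)) (L_ (phi k)) (cyl w) @[k --> \oo] -->
          fine (mu (cyl w))].
Proof.
move=> sT EL L2 kL.
have [phi phiI ephi] := @diagonal_subsequence R (seq bool)
  (fun k w => efreq x (s_ k) (L_ k) (cyl w))
  (fun k w => introT andP (conj (efreq_ge0 _ _ _ _) (efreq_le1 _ _ _ _))).
have phige k := increasing_seq_ge k phiI.
have [mu [muI muC]] : exists mu : probability biseq R,
    invariant_on (orbit_closure x) mu /\
    forall n C, window_set n C ->
    efreq x (s_ (phi k)) (L_ (phi k)) C @[k --> \oo] --> fine (mu C).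
  apply: (@ex_limit_measure R x (s_ \o phi) (L_ \o phi)) => //.
    apply: cvg_inv_nat => k /=.
    exact: leq_trans (phige k) (ltnW (kL _)).
  by move=> k /=; apply: leq_ltn_trans (kL _).
exists phi, mu; split => //; last first.
  by move=> w; exact: muC (@window_cyl w).
have [_ inv] := muI.
apply: (ks_entropy_gt0 measurable_left_shift inv coord_part_finite_partition
  (c := ln 2 / 4)).
  by rewrite divr_gt0 // ln_gt0 // ltr1n.
move=> n; rewrite join_entropyE.
have cH : fin_entropy (fun w : {ffun 'I_n -> 'I_2} =>
    efreq x (s_ (phi k)) (L_ (phi k)) (join_cell left_shift coord_part w))
    @[k --> \oo] -->
    fin_entropy (cell_mass mu left_shift coord_part (n := n)).
  apply: (@cvg_fin_entropy R _ (fun k w => efreq x (s_ (phi k)) (L_ (phi k))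
    (join_cell left_shift coord_part w))) => [k w|w].
    by rewrite efreq_ge0 efreq_le1.
  exact: muC (@join_cell_window n w).
rewrite -(cvg_lim _ cH) //; apply: limr_ge.
  by apply/cvg_ex; eexists; exact: cH.
exists (8 * n)%N => // k /= nk.
apply: window_entropy_ge => //.
exact: leq_trans nk (leq_trans (phige k) (stage_index_le_period _ _)).
Qed.

End EntropyMeasure.

(** * Convergence by periodic approximation *)

Section Approximation.
Context {R : realType}.

Lemma cvg_approx (u : nat -> R) :
  (forall e, 0 < e -> exists2 v : nat -> R, cvgn v &
    \forall n \near \oo, `|u n - v n| <= e) -> cvgn u.
Proof.
move=> H; apply/cauchy_cvgP; apply: cauchy_exP => e e0.
have e2 : 0 < e / 2 by rewrite divr_gt0.
have [v /cvg_ex[l vl] uv] := H _ e2; exists l.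
have /cvgrPdist_lt/(_ _ e2) vl2 := vl.
suff : \forall n \near \oo, ball l e (u n) by [].
apply: filterS2 uv vl2 => n un vn.
rewrite -ball_normE /= (_ : l - u n = (l - v n) - (u n - v n)); last by ring.
by apply: le_lt_trans (ler_normB _ _) _; rewrite [e]splitr ltr_leD.
Qed.

Lemma periodic_cvg (D : pred nat) q : (0 < q)%N ->
  (forall i, D (i + q)%N = D i) -> cvgn (fun N => N%:R^-1 * cnt D N : R).
Proof.
move=> q0 Dq; have q0R : 0 < q%:R :> R by rewrite ltr0n.
set c : R := cnt D q; have c0 : 0 <= c by exact: cnt_ge0.
have cq : c <= q%:R by exact: cnt_leN.
apply/cvg_ex; exists (c / q%:R); apply/cvgrPdist_le => e e0.
exists (Num.trunc (q%:R / e)).+1 => // N /= Ne.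
have N0 : (0 < N)%N by apply: leq_trans Ne.
have N0R : 0 < N%:R :> R by rewrite ltr0n.
have qe : q%:R <= e * N%:R.
  have : q%:R / e < N%:R by apply: lt_le_trans (truncnS_gt _) _; rewrite ler_nat.
  by rewrite ltr_pdivrMr // mulrC => /ltW.
have [r0 rq] : (0 <= N %% q)%N /\ (N %% q < q)%N by rewrite ltn_mod.
have := divn_eq N q; set a := (N %/ q)%N; set r := (N %% q)%N => NE.
have cN : cnt D N = a%:R * c + cnt (fun i => D (a * q + i)%N) r.
  by rewrite {1}NE cntD cnt_periodic.
have t0 : 0 <= cnt (fun i => D (a * q + i)%N) r :> R by exact: cnt_ge0.
have t1 : cnt (fun i => D (a * q + i)%N) r <= r%:R :> R by exact: cnt_leN.
have rR : r%:R <= q%:R :> R by rewrite ler_nat ltnW.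
have NR : N%:R = a%:R * q%:R + r%:R :> R by rewrite {1}NE natrD natrM.
have -> : c / q%:R - N%:R^-1 * cnt D N =
    N%:R^-1 * (r%:R * (c / q%:R) - cnt (fun i => D (a * q + i)%N) r).
  have cqE : c / q%:R = N%:R^-1 * (a%:R * c + r%:R * (c / q%:R)).
    rewrite NR; field.
    by rewrite gt_eqF //= -NR gt_eqF.
  by rewrite {1}cqE cN -mulrBr; congr (_ * _); ring.
rewrite normrM ger0_norm ?invr_ge0 // mulrC ler_pdivrMr //.
apply: le_trans qe.
have c1 : r%:R * (c / q%:R) <= q%:R.
  apply: le_trans rR; rewrite ler_piMr // ler_pdivrMr // mul1r //.
have c2 : 0 <= r%:R * (c / q%:R) by rewrite mulr_ge0 // divr_ge0.
by rewrite ler_norml; move: (cnt _ r) t0 t1 => t t0 t1; lra.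
Qed.

End Approximation.

(** * Genericity when the stages are sparse *)

Section Genericity.
Context {R : realType}.
Variable S : stages R.
Notation Q := (stage_period S).
Notation T := (stage_start S).
Notation E := (stage_end S).
Notation A := (stage_set S).
Notation B := (stage_union S).
Notation x := (eta B).
Notation cnt := (@cnt R).

Definition stage_approx (k : nat) : biseq := fun n => ~~ old_multiple S k `|n|%N.

Lemma stage_approx_periodic k (n : int) :
  stage_approx k (n + (Q k)%:Z) = stage_approx k n.
Proof.
congr negb; apply: eq_in_has => i; rewrite mem_iota => /= ik.
apply: eq_in_has => a aA; rewrite -[a]/`|a%:Z|%N -!dvdzE rpredDr //.
by rewrite dvdzE; exact: (stage_set_dvd ik).
Qed.

Lemma stage_approx_cvg k C :
  cvgn (fun N => efreq (R := R) (stage_approx k) 1 N C).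
Proof.
apply: (@periodic_cvg R _ (Q k)) => [|i]; first exact: stage_period_gt0.
congr (`[< C _ >]); apply/funext => n; rewrite /shiftz addnA PoszD addrA.
exact: stage_approx_periodic.
Qed.

(** Stages from [k] on; the range [iota k y] is long enough because an element of stage [i] exceeds
    [i]. *)
Definition new_multiple (k y : nat) : bool :=
  (0 < y)%N && has (fun i => has (dvdn ^~ y) (A i)) (iota k y).

Lemma eta_approx_neq k (y : nat) : (0 < y)%N ->
  x y%:Z != stage_approx k y%:Z -> new_multiple k y.
Proof.
move=> y0; rewrite eta_multiples /stage_approx /= => neq.
rewrite /new_multiple y0 /=.
have [oldy|newy] := boolP (old_multiple S k y).
  have yB : y%:Z \in multiples B.
    by apply/mem_multiples; move/hasP: oldy => [i _ Ai]; exists i.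
  by rewrite yB oldy in neq.
have yB : y%:Z \in multiples B by move: neq; rewrite newy; case: (_ \in _).
have [i Ai] := (mem_multiples S y%:Z).1 yB.
apply/hasP; exists i => //; rewrite mem_iota.
have [ik|ki] := ltnP i k.
  by case/hasP: newy; exists i; rewrite // mem_iota.
have [b bA /(dvdn_leq y0) b_le_y] := hasP Ai.
move: bA; rewrite mem_stage_set => /and3P[/andP[Tb _] _ _].
have := stage_index_lt S i; move: ki b_le_y Tb; rewrite /=; lia.
Qed.

Hypothesis ratioE : forall k, stage_ratio S k = (2 ^ k)%N.

(** Stage [i] has at most [T i / 2 ^ i] elements, all at least [T i], so its multiples have
    frequency at most [1 / 2 ^ i]; the geometric tail from [k] is summed. *)
Lemma cnt_new_multiple k N :
  cnt (new_multiple k) N.+1 <= N%:R * (2 * (2 ^+ k)^-1).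
Proof.
pose F i y := has (fun a => (0 < y) && (a %| y))%N (A i).
apply: (@le_trans _ _ (cnt (fun y => has (F ^~ y) (iota k N)) N.+1)).
  apply: cnt_le => y yN /andP[y0 /hasP[i]]; rewrite mem_iota => iy /hasP[a aA ay].
  apply/hasP; exists i; first by rewrite mem_iota; lia.
  by apply/hasP; exists a; rewrite ?y0.
apply: le_trans (cnt_has _ _ _) _.
have p2 i : 0 < 2 ^+ i :> R by rewrite exprn_gt0.
apply: (@le_trans _ _ (\sum_(i <- iota k N) N%:R * (2 ^+ i)^-1)).
  apply: ler_sum => i _; apply: le_trans (cnt_has _ _ _) _.
  have W0 : 0 < (2 ^ Q i * Q i)%N%:R :> R.
    by rewrite ltr0n muln_gt0 expn_gt0 stage_period_gt0.
  apply: (@le_trans _ _ (\sum_(a <- A i) N%:R / (T i)%:R)).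
    rewrite big_seq [leRHS]big_seq; apply: ler_sum => a.
    rewrite mem_stage_set => /and3P[/andP[Ta _] _ _].
    have T0 : (0 < T i)%N by have := stage_start_gt1 S i; lia.
    apply: le_trans (cnt_dvd_le _ _) _; first exact: leq_trans Ta.
    apply: ler_wpM2l => //; rewrite lef_pV2 ?posrE ?ltr0n ?ler_nat //.
    exact: leq_trans Ta.
  rewrite big_const_seq count_predT iter_addr addr0 -mulrnAr.
  apply: ler_wpM2l => //; rewrite -[leLHS]mulr_natl.
  rewrite /stage_start ratioE natrM invfM natrX mulrC -mulrA.
  apply: ler_piMr; first by rewrite invr_ge0 ltW.
  by rewrite mulrC ler_pdivrMr // mul1r ler_nat size_stage_set.
rewrite -mulr_sumr; apply: ler_wpM2l => //.
suff -> : \sum_(i <- iota k N) (2 ^+ i)^-1 =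
    2 * (2 ^+ k)^-1 - 2 * (2 ^+ (k + N))^-1 :> R.
  by rewrite gerBl mulr_ge0 // invr_ge0 ltW.
elim: N => [|N IHN]; first by rewrite big_nil addn0 subrr.
rewrite -addn1 iotaD big_cat IHN /= big_seq1 addnA addn1 exprS.
have := p2 (k + N)%N; move: (2 ^+ (k + N)) (2 ^+ k) (p2 k) => t s s0 t0.
by field; rewrite !gt_eqF.
Qed.

Lemma absz_zidx_le j : (`|zidx j| <= j)%N.
Proof.
rewrite -{2}(odd_double_half j) /zidx; case: (odd j) => /=; lia.
Qed.

Lemma cnt_approx_neq k m (j : nat) N : (j < m)%N ->
  cnt (fun i => x (zidx j + (1 + i)%N%:Z) !=
                stage_approx k (zidx j + (1 + i)%N%:Z)) N <=
  m%:R + (N + 2 * m)%N%:R * (2 * (2 ^+ k)^-1).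
Proof.
move=> jm; set D := fun i => _.
have p2 : 0 < 2 ^+ k :> R by rewrite exprn_gt0.
have t0 : 0 <= (N + 2 * m)%N%:R * (2 * (2 ^+ k)^-1) :> R.
  by rewrite mulr_ge0 // mulr_ge0 // invr_ge0 ltW.
have [Nm|mN] := leqP N m.
  apply: (@le_trans _ _ m%:R); last by rewrite lerDl.
  by apply: le_trans (cnt_leN _ _) _; rewrite ler_nat.
(* The coordinate [zidx j] may be negative. Dropping the first [m] positions makes all the others
   positive, and they stay below [N + 2 * m]. *)
rewrite -[X in cnt _ X](subnKC (ltnW mN)) cntD; apply: lerD; first exact: cnt_leN.
have zm := absz_zidx_le j.
pose c := `|(zidx j + (1 + m)%N%:Z)%R|%N.
have cE i : zidx j + (1 + (m + i))%N%:Z = (c + i)%N%:Z by rewrite /c; lia.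
have c0 : (0 < c)%N by rewrite /c; lia.
have c2 : (c <= 2 * m)%N by rewrite /c; lia.
apply: le_trans (cnt_new_multiple k (N + 2 * m)).
apply: (@le_trans _ _ (cnt (fun i => new_multiple k (c + i)) (N - m))).
  apply: cnt_le => i _; rewrite /D cE; apply: eta_approx_neq.
  by rewrite addn_gt0 c0.
apply: (@le_trans _ _ (cnt (new_multiple k) (c + (N - m)))).
  by rewrite cntD lerDr cnt_ge0.
by apply: cnt_widen; lia.
Qed.

(** Visits to [C] can differ only where one of [m] coordinates does; [cnt_approx_neq] is summed over
    these coordinates, with [m ^ 2 + 4 * m ^ 2] bounding the boundary terms. *)
Lemma efreq_approx k m C N : window_set m C -> (0 < N)%N ->
  `|efreq x 1 N C - efreq (stage_approx k) 1 N C| <=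
  m%:R * (2 * (2 ^+ k)^-1) + 5 * m%:R ^+ 2 / N%:R :> R.
Proof.
move=> Cm N0; have NR : 0 < N%:R :> R by rewrite ltr0n.
have p2 : 1 <= 2 ^+ k :> R by rewrite exprn_ege1 // ler1n.
rewrite /efreq -mulrBr normrM ger0_norm ?invr_ge0 // mulrC ler_pdivrMr //.
pose F j i := x (zidx j + (1 + i)%N%:Z) != stage_approx k (zidx j + (1 + i)%N%:Z).
apply: (@le_trans _ _ (cnt (fun i => has (F ^~ i) (iota 0 m)) N)).
  rewrite /cnt -sumrB; apply: le_trans (ler_norm_sum _ _ _) _.
  apply: ler_sum => i _.
  case: (boolP (has _ _)) => [_|/hasPn agr].
    case: `[< _ >]; case: `[< _ >];
      by rewrite ?subrr ?normr0 ?subr0 ?sub0r ?normrN ?normr1.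
  have ag : agree m (shiftz (1 + i)%N%:Z x) (shiftz (1 + i)%N%:Z (stage_approx k)).
    move=> j jm; have := agr j; rewrite mem_iota => /(_ jm).
    by rewrite /F negbK => /eqP.
  rewrite (_ : `[< C _ >] = `[< C (shiftz (1 + i)%N%:Z (stage_approx k)) >]).
    by rewrite subrr normr0.
  apply/asboolP/asboolP; apply: Cm => // j jm.
  by rewrite ag.
apply: le_trans (cnt_has _ _ _) _.
apply: (@le_trans _ _ (\sum_(j <- iota 0 m)
    (m%:R + (N + 2 * m)%N%:R * (2 * (2 ^+ k)^-1)))).
  rewrite big_seq [leRHS]big_seq; apply: ler_sum => j; rewrite mem_iota => jm.
  exact: cnt_approx_neq.
rewrite big_const_seq count_predT size_iota iter_addr addr0 -[leLHS]mulr_natl.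
rewrite natrD natrM.
have t0 : 0 < (2 ^+ k)^-1 :> R by rewrite invr_gt0 exprn_gt0.
have t1 : (2 ^+ k)^-1 <= 1 :> R by rewrite invf_le1 // exprn_gt0.
rewrite [leRHS]mulrDl divfK ?gt_eqF //.
move: (2 ^+ k)^-1 t0 t1 => t t0 t1.
have m0 := ler0n R m.
have : m%:R * m%:R * t <= m%:R * m%:R :> R by rewrite ler_piMr // mulr_ge0.
by lra.
Qed.

Lemma stage_efreq_cvg m C : window_set m C ->
  cvgn (fun N => efreq (R := R) x 1 N C).
Proof.
move=> Cm; apply: cvg_approx => e e0.
pose k := (Num.trunc (4 * m%:R / e)).+1.
exists (fun N => efreq (stage_approx k) 1 N C); first exact: stage_approx_cvg.
have k2 : m%:R * (2 * (2 ^+ k)^-1) <= e / 2 :> R.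
  have : 4 * m%:R / e <= 2 ^+ k.
    apply: ltW; apply: lt_trans (truncnS_gt _) _.
    by rewrite -natrX ltr_nat; exact: ltn_expl.
  rewrite ler_pdivrMr // mulrA ler_pdivrMr ?exprn_gt0 //.
  by move: (2 ^+ k) => t; lra.
exists (Num.trunc (10 * m%:R ^+ 2 / e)).+1 => // N /= Ne.
have N0 : (0 < N)%N by apply: leq_trans Ne.
apply: le_trans (efreq_approx k Cm N0) _.
have : 10 * m%:R ^+ 2 / e < N%:R.
  by apply: lt_le_trans (truncnS_gt _) _; rewrite ler_nat.
rewrite ltr_pdivrMr // => h.
have : 5 * m%:R ^+ 2 / N%:R <= e / 2 by rewrite ler_pdivrMr ?ltr0n //; lra.
by lra.
Qed.

Lemma stage_generic : exists mu : probability biseq R,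
  invariant_on (orbit_closure x) mu /\
  forall w, efreq x 1 N (cyl w) @[N --> \oo] --> fine (mu (cyl w)).
Proof.
(* The index is shifted since [ex_limit_measure] asks for positive lengths. *)
have ecvg w : cvgn (fun k => efreq (R := R) x 1 k.+1 (cyl w)).
  have /cvg_ex[l cl] := stage_efreq_cvg (@window_cyl w).
  by apply/cvg_ex; exists l; rewrite -cvg_shiftS in cl.
have [mu [muI muC]] := ex_limit_measure (cvg_inv_nat (fun k => leqnSn k))
  (fun k => ltn0Sn k) ecvg.
exists mu; split=> // w; rewrite -cvg_shiftS; exact: muC (@window_cyl w).
Qed.

Lemma stage_besicovitch : besicovitch R B.
Proof.
apply: cvg_has_density.
have -> : freq R (multiples B) = fun N => efreq x 1 N [set y : biseq | y 0 = false].
  apply/funext => N; rewrite /freq /efreq /cnt natr_sum; congr (_ * _).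
  rewrite big_add1 /=; apply: eq_bigr => i _; congr (_ : bool)%:R.
  by rewrite /shiftz add0r eta_multiples; apply/idP/asboolP; case: (_ \in _).
apply: (@stage_efreq_cvg 1) => y z yz /= <-.
by apply/esym; exact: (yz 0%N).
Qed.

End Genericity.

Lemma increasing_seq_cvgoo (f : nat -> nat) : increasing_seq f ->
  f k @[k --> \oo] --> \oo.
Proof.
move=> fI P [M _ MP]; exists M => // k /= Mk; apply: MP.
exact: leq_trans Mk (increasing_seq_ge _ fI).
Qed.

(** * The two examples *)

Section Main.
Variable R : realType.

(** With ratio 1, the stage window fills at least half of [1, E k), so the empirical measures for
    [N = E k - 1] have a limit of positive entropy. *)
Lemma non_besicovitch_example : exists B : set nat,
  [/\ B `<=` [set b | (1 < b)%N], irregular_toeplitz R (eta B),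
      ~ besicovitch R B &
      exists mu : probability biseq R,
        [/\ invariant_on (orbit_closure (eta B)) mu,
            quasi_generic (eta B) mu & has_positive_entropy mu]].
Proof.
have [S c1] := @ex_stages R (fun=> 1%N) (fun=> isT).
exists (stage_union S); split.
- exact: stage_union_gt1.
- exact: stage_irregular.
- exact: stage_not_besicovitch.
have TW k : stage_end S k =
    (2 * (2 ^ stage_period S k * stage_period S k))%N.
  by rewrite /stage_end /stage_start c1 mul1n mul2n addnn.
have kT k : (k < stage_start S k)%N by exact: stage_index_lt.
have TE k : (stage_start S k < stage_end S k)%N by exact: stage_start_lt_end.
have [||||phi [mu [phiI muI muE muC]]] := @stage_entropy_measure R S
  (fun=> 1%N) (fun k => (stage_end S k).-1).
- by move=> k; have := stage_start_gt1 S k; lia.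
- by move=> k; have := TE k; lia.
- by move=> k; rewrite -TW; lia.
- by move=> k; have := TE k; have := kT k; lia.
exists mu; split=> //.
exists (fun k => (stage_end S (phi k)).-1); last exact: weak_cvg_empirical.
apply/increasing_seqP => k.
have phik : (phi k < phi k.+1)%N by have /increasing_seqP := phiI; apply.
have := stage_end_start S phik; have := TE (phi k); have := TE (phi k.+1).
by rewrite ltEnat /=; lia.
Qed.

(** The empirical measures converge along all [N], which makes the limit the Mirsky measure.
    Positive entropy comes from the segments [T k, E k) themselves, a vanishing part of [1, E k]. *)
Lemma besicovitch_example : exists B : set nat,
  [/\ B `<=` [set b | (1 < b)%N], irregular_toeplitz R (eta B),
      besicovitch R B,
      (exists mu : probability biseq R, mirsky B mu /\ generic (eta B) mu) &
      exists mu : probability biseq R,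
        invariant_on (orbit_closure (eta B)) mu /\ has_positive_entropy mu].
Proof.
have [S cE] := @ex_stages R (fun k => 2 ^ k)%N (fun k => expn_gt0 2 k).
exists (stage_union S); split.
- exact: stage_union_gt1.
- exact: stage_irregular.
- exact: stage_besicovitch.
- have [mu [muI muC]] := stage_generic cE.
  exists mu; split; last exact: weak_cvg_empirical.
  split=> // N_ NI _; apply: weak_cvg_empirical => w.
  exact: (cvg_comp _ _ (increasing_seq_cvgoo NI) (muC w)).
- have [||||phi [mu [phiI muI muE muC]]] := @stage_entropy_measure R S
    (stage_start S) (fun k => 2 ^ stage_period S k * stage_period S k)%N.
  + by [].
  + by [].
  + by move=> k; rewrite leq_pmull.
  + exact: stage_index_lt_width.
  by exists mu.
Qed.

End Main.

Local Close Scope ring_scope.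

Theorem theorem1 (R : realType) :
  let base (B : set nat) : Prop :=
    [/\ B `<=` [set b | (1 < b)%N],
        irregular_toeplitz R (eta B) &
        exists mu : probability biseq R,
          invariant_on (orbit_closure (eta B)) mu /\ has_positive_entropy mu] in
  [/\ exists B : set nat, base B,
      exists B : set nat,
        [/\ base B, ~ besicovitch R B &
            exists mu : probability biseq R,
              [/\ invariant_on (orbit_closure (eta B)) mu,
                  quasi_generic (eta B) mu &
                  has_positive_entropy mu]] &
      exists B : set nat,
        [/\ base B, besicovitch R B,
            exists mu : probability biseq R,
              mirsky B mu /\ generic (eta B) mu &
            exists mu : probability biseq R,
              invariant_on (orbit_closure (eta B)) mu /\
              has_positive_entropy mu]].
Proof.
have [B1 [B1gt1 B1irr B1nb [mu1 [mu1I mu1q mu1e]]]] := non_besicovitch_example R.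
have [B2 [B2gt1 B2irr B2b B2g B2e]] := besicovitch_example R.
have base1 : [/\ B1 `<=` [set b | (1 < b)%N], irregular_toeplitz R (eta B1) &
    exists mu : probability biseq R,
      invariant_on (orbit_closure (eta B1)) mu /\ has_positive_entropy mu].
  by split=> //; exists mu1.
split; first by exists B1.
- by exists B1; split=> //; exists mu1.
- by exists B2.
Qed.
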